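(* Let $\mathcal{H}$ be a real Hilbert space, let $A:\mathcal{H}\rightrightarrows\mathcal{H}$ be maximally monotone, let $D:\mathcal{H}\to\mathcal{H}$ be $L_D^{-1}$-cocoercive and $B:\mathcal{H}\to\mathcal{H}$ be $L_B^{-1}$-cocoercive, with $L_D,L_B>0$, and let $C=\operatorname{zer}B$. Let $\gamma,\lambda,\beta:[0,+\infty)\to(0,+\infty)$ be continuous on each interval $[0,b]$, $0<b<+\infty$. Let $u_0,v_0\in\mathcal{H}$ and let $x$ be the unique strong global solution of $$\ddot{x}(t)+\gamma(t)\dot{x}(t)+x(t)=J_{\lambda(t)A}\big(x(t)-\lambda(t)D(x(t))-\lambda(t)\beta(t)B(x(t))\big),\qquad x(0)=u_0,\ \dot{x}(0)=v_0.$$ Suppose that: - $A+N_C$ is maximally monotone and $\operatorname{zer}(A+D+N_C)\neq\emptyset$; - $\lambda\in L^2([0,+\infty))\setminus L^1([0,+\infty))$ and $\lim_{t\to+\infty}\lambda(t)=0$; - for every $p\in\operatorname{ran}N_C$, $\displaystyle\int_0^{+\infty}\lambda(t)\beta(t)\left(\sup_{u\in C}\varphi_B\left(u,\frac{p}{\beta(t)}\right)-\sigma_C\left(\frac{p}{\beta(t)}\right)\right)dt<+\infty$; - $\limsup_{t\to+\infty}\lambda(t)\beta(t)<\frac{1}{L_B}$; - $\gamma$ is locally absolutely continuous, and for almost every $t\ge0$ one has $\gamma(t)\ge\sqrt{2}$ and $\dot{\gamma}(t)\le0$. For $t>0$ let $$\tilde{x}(t)=\frac{1}{\int_0^t\lambda(s)\,ds}\int_0^t\lambda(s)x(s)\,ds.$$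 Then the following statements hold: (i) for every $x^*\in\operatorname{zer}(A+D+N_C)$, $\|x(t)-x^*\|$ converges as $t\to+\infty$; in addition, $\dot{x},\ddot{x}\in L^2([0,+\infty),\mathcal{H})$, $\lambda(\cdot)\beta(\cdot)\|B(x(\cdot))\|^2\in L^1([0,+\infty))$, $\int_0^{+\infty}\lambda(t)\beta(t)\langle B(x(t)),x(t)-x^*\rangle\,dt<+\infty$, and $\lim_{t\to+\infty}\dot{x}(t)=0$ and $\lim_{t\to+\infty}\dot{h}(t)=0$, where $h(t)=\frac12\|x(t)-x^*\|^2$; (ii) $\tilde{x}(t)$ converges weakly as $t\to+\infty$ to an element of $\operatorname{zer}(A+D+N_C)$; (iii) if, additionally, $A$ is strongly monotone, then $x(t)$ converges strongly as $t\to+\infty$ to the unique element of $\operatorname{zer}(A+D+N_C)$.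
   Context: A single-valued operator $T:\mathcal{H}\to\mathcal{H}$ is $\kappa$-cocoercive ($\kappa>0$) if $\langle x-y,Tx-Ty\rangle\ge\kappa\|Tx-Ty\|^2$ for all $x,y\in\mathcal{H}$. For a set-valued operator $T:\mathcal{H}\rightrightarrows\mathcal{H}$: $\operatorname{Gr}T=\{(x,u):u\in Tx\}$, $\operatorname{zer}T=\{x:0\in Tx\}$, $\operatorname{ran}T=\{u:\exists x,\ u\in Tx\}$. $T$ is strongly monotone if there is $\eta>0$ with $\langle u-v,x-y\rangle\ge\eta\|x-y\|^2$ for all $(x,u),(y,v)\in\operatorname{Gr}T$. For $A$ maximally monotone and $\alpha>0$, $J_{\alpha A}=(\mathrm{Id}+\alpha A)^{-1}$ is the (single-valued, everywhere defined) resolvent. $N_C$ is the normal cone operator of $C$: $N_C(x)=\{u\in\mathcal{H}:\langle y-x,u\rangle\le0\ \forall y\in C\}$ if $x\in C$, and $N_C(x)=\emptyset$ if $x\notin C$. $\sigma_C(u)=\sup_{y\in C}\langle y,u\rangle$ is the support function of $C$. The Fitzpatrick function of $B$ is $$\varphi_B(x,u)=\sup_{y\in\mathcal{H}}\{\langle x,By\rangle+\langle y,u\rangle-\langle y,By\rangle\}\in\mathbb{R}\cup\{+\infty\}.$$ A function $x:[0,+\infty)\to\mathcal{H}$ is a strong global solution of the dynamical system if $x$ and $\dot{x}$ are locally absolutely continuous on $[0,+\infty)$ (absolutely continuous on each $[0,b]$, $0<b<+\infty$), the differential equation holds for almost every $t\ge0$, and $x(0)=u_0$, $\dot{x}(0)=v_0$.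 Under the stated continuity of $\gamma,\lambda,\beta$ such a solution exists and is unique for all $u_0,v_0\in\mathcal{H}$. *)

(* Defs.v *)
From HB Require Import structures.
From mathcomp Require Import all_boot all_order all_algebra.
From mathcomp Require Import all_classical all_reals all_analysis.

Set Implicit Arguments.
Unset Strict Implicit.
Unset Printing Implicit Defensive.

Import Order.TTheory GRing.Theory Num.Theory.
Import numFieldNormedType.Exports.

Local Open Scope classical_set_scope.
Local Open Scope ring_scope.

(* A real Hilbert space is a completeNormedModType R together with an inner
   product, i.e. a symmetric positive definite bilinear form, which induces the
   norm. *)
Definition induces_norm (R : realType) (H : completeNormedModType R)
    (ip : {dot H for idfun}) : Prop :=
  forall x : H, `|x| ^+ 2 = ip x x.

Section operators.
Context {R : realType} {H : completeNormedModType R} (ip : {dot H for idfun}).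
Implicit Types (T S : H -> set H) (F : H -> H) (C : set H).

Definition gr T : set (H * H) := [set p | T p.1 p.2].
Definition zer T : set H := [set x | T x 0].
Definition ran T : set H := [set u | exists x, T x u].

(* A single-valued operator seen as a set-valued one. *)
Definition single F : H -> set H := fun x => [set F x].

Definition op_add T S : H -> set H :=
  fun x => [set w | exists u v, [/\ T x u, S x v & w = u + v]].

Definition op_scale (a : R) T : H -> set H := fun x => [set a *: u | u in T x].

Definition op_inv T : H -> set H := fun u => [set x | T x u].

Definition monotone T : Prop :=
  forall x u y v, gr T (x, u) -> gr T (y, v) -> 0 <= ip (u - v) (x - y).

Definition maximally_monotone T : Prop :=
  monotone T /\
  (forall S, monotone S -> gr T `<=` gr S -> gr S `<=` gr T).

Definition strongly_monotone T : Prop :=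
  exists2 eta : R, 0 < eta &
    forall x u y v, gr T (x, u) -> gr T (y, v) ->
      eta * `|x - y| ^+ 2 <= ip (u - v) (x - y).

Definition cocoercive (kappa : R) F : Prop :=
  0 < kappa /\
  (forall x y, kappa * `|F x - F y| ^+ 2 <= ip (x - y) (F x - F y)).

(* J_{aT} = (Id + aT)^{-1} as a set-valued operator; it is single-valued with
   full domain when T is maximally monotone and a > 0, and then
   [resolvent a T y = [set z]] reads J_{aT} y = z. *)
Definition resolvent (a : R) T : H -> set H :=
  op_inv (op_add (single id) (op_scale a T)).

Definition normal_cone C : H -> set H :=
  fun x => [set u | C x /\ forall y, C y -> ip (y - x) u <= 0].

Definition support_fun C (u : H) : \bar R :=
  ereal_sup [set (ip y u)%:E | y in C].

Definition fitzpatrick F (x u : H) : \bar R :=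
  ereal_sup [set (ip x (F y) + ip y u - ip y (F y))%:E | y in [set: H]].

Definition weakly_cvg_pinfty (f : R -> H) (z : H) : Prop :=
  forall y : H, ip (f t) y @[t --> +oo] --> ip z y.

End operators.

(* Functions on [0, +oo[ are represented by functions on R whose values at
   negative arguments play no role. *)
Section half_line.
Context {R : realType}.
Local Notation mu := (@lebesgue_measure R).

Section calculus.
Context {V : normedModType R}.
Implicit Types f g : R -> V.

(* Difference quotients are taken inside [0, +oo[, so that the derivative is
   one-sided at 0. *)
Definition diff_quotients f (t : R) : set_system V :=
  (s - t)^-1 *: (f s - f t) @[s --> within `[0, +oo[ t^'].

Definition hderivable f (t : R) : Prop := cvg (diff_quotients f t).

Definition hderiv f (t : R) : V := lim (diff_quotients f t).

Definition abs_continuous (a b : R) f : Prop :=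
  forall e : R, 0 < e -> exists2 d : R, 0 < d &
    forall (n : nat) (l r : 'I_n -> R),
      (forall i, [/\ a <= l i, l i <= r i & r i <= b]) ->
      trivIset [set: 'I_n] (fun i => `]l i, r i[%classic) ->
      \sum_(i < n) (r i - l i) < d ->
      \sum_(i < n) `|f (r i) - f (l i)| < e.

Definition locally_abs_continuous f : Prop :=
  forall b : R, 0 < b -> abs_continuous 0 b f.

(* A simple function takes finitely many values, each of them on a measurable
   set; it is integrable on D when its nonzero values are taken on parts of D
   of finite measure. *)
Definition simple_fun f : Prop :=
  finite_set (range f) /\ forall v, measurable (f @^-1` [set v]).

Definition integrable_simple_fun (D : set R) f : Prop :=
  simple_fun f /\
  forall v, v != 0 -> (mu (D `&` f @^-1` [set v]) < +oo)%E.

Definition simple_integral (D : set R) f : V :=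
  \sum_(v \in [set: V]) fine (mu (D `&` f @^-1` [set v])) *: v.

Definition strongly_measurable (D : set R) f : Prop :=
  exists s : nat -> R -> V, (forall n, simple_fun (s n)) /\
    {ae mu, forall t, D t -> s n t @[n --> \oo] --> f t}.

Definition is_bochner_integral (D : set R) f (v : V) : Prop :=
  strongly_measurable D f /\
  exists s : nat -> R -> V,
    [/\ forall n, integrable_simple_fun D (s n),
        (\int[mu]_(t in D) (`|f t - s n t|)%:E)%E @[n --> \oo] --> 0%E
      & simple_integral D (s n) @[n --> \oo] --> v].

Definition bochner_integral (D : set R) f : V :=
  xget 0 [set v | is_bochner_integral D f v].

Definition square_integrable (D : set R) f : Prop :=
  strongly_measurable D f /\
  (\int[mu]_(t in D) (`|f t| ^+ 2)%:E < +oo)%E.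

End calculus.

Definition positive_continuous (f : R -> R) : Prop :=
  (forall t, 0 <= t -> 0 < f t) /\
  (forall b, 0 < b -> {within `[0, b], continuous f}).

Section dynamics.
Context {H : completeNormedModType R}.

Definition strong_global_solution (A : H -> set H) (D B : H -> H)
    (gamma lambda beta : R -> R) (u0 v0 : H) (x : R -> H) : Prop :=
  [/\ forall t, 0 <= t -> hderivable x t,
      locally_abs_continuous x,
      locally_abs_continuous (hderiv x),
      {ae mu, forall t, 0 <= t ->
        hderivable (hderiv x) t /\
        resolvent (lambda t) A
          (x t - lambda t *: D (x t) - (lambda t * beta t) *: B (x t)) =
        [set hderiv (hderiv x) t + gamma t *: hderiv x t + x t]}
    & x 0 = u0 /\ hderiv x 0 = v0].

Definition weighted_average (lambda : R -> R) (x : R -> H) (t : R) : H :=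
  (\int[mu]_(s in `[0, t]) lambda s)^-1 *:
    bochner_integral `[0, t] (fun s => lambda s *: x s).

End dynamics.
End half_line.

(* Main.v *)
(** Put q = x'' + gamma x'.  Monotonicity of A along the trajectory, Young's
    inequality for the cross terms and cocoercivity of B and D show that the
    Lyapunov function
      20 <x - u, x'> + gamma (10 |x - u|^2 + 11 |x'|^2),
    coercive because gamma >= sqrt 2, decreases up to an integrable error, the
    Fitzpatrick condition controlling the part of the error that comes from the
    normal cone.  Its dissipation contains |x''|^2, |x'|^2, lambda |Dx - Du|^2
    and lambda beta <Bx, x - u>, which are therefore integrable; since x'' is
    only defined almost everywhere, this uses Fatou's lemma for difference
    quotients of the Lyapunov function rather than integration of derivatives.

    The weak limit of the averages is found as in Opial's lemma.  Because
    lambda |Dx - Dx*|^2 is integrable, Dx tends to Dx* on average; hence a weak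
    cluster point z of the averages satisfies -Dx* in (A + N_C) z by maximality
    of A + N_C, and Dz = Dx* by monotonicity and continuity of D, so that
    maximality of A + D + N_C is never needed. *)
Require Import Defs.
From HB Require Import structures.
From mathcomp Require Import all_boot all_order all_algebra.
From mathcomp Require Import all_classical all_reals all_analysis.
From mathcomp Require Import measurable_realfun ring lra.

Set Implicit Arguments.
Unset Strict Implicit.
Unset Printing Implicit Defensive.

Import Order.TTheory GRing.Theory Num.Theory.
Import numFieldNormedType.Exports.

Local Open Scope classical_set_scope.
Local Open Scope ring_scope.

(** * Hilbert spaces *)

(** The constants come from a cancellation. Twenty times the basic monotonicity estimate contains 20
    <x - u, q> + 11 |q|^2; its mixed terms 20 <x - u, x''>, 20 gamma <x - u, x'> and 22 gamma <x',
    x''> are exactly those in the derivative of the Lyapunov function. What is left over is 11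
    |x''|^2 + (11 gamma^2 - 20) |x'|^2, so gamma^2 >= 2 also yields the dissipation 2 |x'|^2, and
    gamma' <= 0 gives the last term a favourable sign.

    Differential inequalities are integrated through a monotonicity criterion for absolutely
    continuous functions, and most integrability claims are recast as upper bounds on primitives of
    continuous functions. Such one-sided bounds make sense for signed integrands too, which is what
    the averages require. Weak compactness is reached through ultrafilters and the Riesz
    representation, and vector integrals are handled by pairing them with fixed vectors. *)

Lemma near_harmonic_lt (R : realType) (e : R) : 0 < e ->
  \forall n \near \oo, n.+1%:R^-1 < e.
Proof. by move=> e0; exact: (@cvgr_lt _ _ _ _ _ _ (@cvg_harmonic R) _ e0). Qed.

Section hilbert.
Context {R : realType} {H : completeNormedModType R}.
Variables (ip : {dot H for idfun}) (ip_norm : induces_norm ip).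
Implicit Types x y z : H.

Lemma ipC x y : ip x y = ip y x.
Proof. by rewrite hermC expr0 mul1r. Qed.

Lemma ipDl x y z : ip (x + y) z = ip x z + ip y z.
Proof. exact: linearDl. Qed.

Lemma ipDr x y z : ip z (x + y) = ip z x + ip z y.
Proof. exact: linearDr. Qed.

Lemma ipBl x y z : ip (x - y) z = ip x z - ip y z.
Proof. exact: linearBl. Qed.

Lemma ipBr x y z : ip z (x - y) = ip z x - ip z y.
Proof. exact: linearBr. Qed.

Lemma ipNl x z : ip (- x) z = - ip x z.
Proof. by rewrite -sub0r ipBl linear0l sub0r. Qed.

Lemma ipNr x z : ip z (- x) = - ip z x.
Proof. by rewrite -sub0r ipBr linear0r sub0r. Qed.

Lemma ipZl a x y : ip (a *: x) y = a * ip x y.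
Proof. by rewrite linearZl_LR. Qed.

Lemma ipZr a x y : ip x (a *: y) = a * ip x y.
Proof. by rewrite ipC ipZl ipC. Qed.

Definition ipE := (ipDl, ipDr, ipBl, ipBr, ipNl, ipNr, ipZl, ipZr).

Lemma ip_sqr x : ip x x = `|x| ^+ 2.
Proof. by rewrite ip_norm. Qed.

Lemma norm_sqrD x y : `|x + y| ^+ 2 = `|x| ^+ 2 + 2 * ip x y + `|y| ^+ 2.
Proof. rewrite !ip_norm !ipE [ip y x]ipC; ring. Qed.

Lemma norm_sqrB x y : `|x - y| ^+ 2 = `|x| ^+ 2 - 2 * ip x y + `|y| ^+ 2.
Proof. rewrite norm_sqrD normrN ipNr; ring. Qed.

(** Cauchy-Schwarz: the squared norm of |y| x - |x| y is nonnegative, and its expansion is divided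
    by |x| |y|. *)
Lemma ip_le x y : ip x y <= `|x| * `|y|.
Proof.
have [->|y0] := eqVneq y 0; first by rewrite linear0r mulr_ge0.
have n0 : 0 < `|y| by rewrite normr_gt0.
have : 0 <= `| `|y| *: x - `|x| *: y| ^+ 2 by rewrite sqr_ge0.
rewrite norm_sqrB !normrZ !normr_id ipZl ipZr => h.
have [->|x0] := eqVneq x 0; first by rewrite linear0l normr0 mul0r.
have m0 : 0 < `|x| by rewrite normr_gt0.
have p0 : 0 < `|x| * `|y| by rewrite mulr_gt0.
rewrite -(ler_pM2l p0); nra.
Qed.

Lemma ip_normM x y : `|ip x y| <= `|x| * `|y|.
Proof.
rewrite ler_norml ip_le andbT lerNl -ipNl -[`|x|]normrN; exact: ip_le.
Qed.

(** Polarisation reduces joint continuity of the inner product to continuity of the norm. *)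
Lemma cvg_ip {T : Type} (F : set_system T) {FF : Filter F} (f g : T -> H) a b :
  f @ F --> a -> g @ F --> b -> (fun t => ip (f t) (g t)) @ F --> ip a b.
Proof.
move=> fa gb.
have -> : (fun t => ip (f t) (g t)) =
  (fun t => 4^-1 * (`|f t + g t| ^+ 2 - `|f t - g t| ^+ 2)).
  by apply/funext => t; rewrite norm_sqrD norm_sqrB; field.
have -> : ip a b = 4^-1 * (`|a + b| ^+ 2 - `|a - b| ^+ 2).
  by rewrite norm_sqrD norm_sqrB; field.
apply: cvgMr; apply: cvgB.
  by rewrite expr2; apply: cvgM; apply: cvg_norm; apply: cvgD.
by rewrite expr2; apply: cvgM; apply: cvg_norm; apply: cvgB.
Qed.

(* The representing vector minimises z |-> |z|^2 - 2 l z; minimising sequences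
   are Cauchy by the parallelogram identity. *)
Lemma riesz (l : H -> R) (M : R) :
  (forall x y, l (x + y) = l x + l y) -> (forall a x, l (a *: x) = a * l x) ->
  (forall x, `|l x| <= M * `|x|) -> exists z, forall y, ip z y = l y.
Proof.
move=> lD lZ lM.
pose phi z : R := `|z| ^+ 2 - 2 * l z.
pose E := [set phi z | z in [set: H]].
have lphi z : - M ^+ 2 <= phi z.
  have := lM z; rewrite ler_norml => /andP[_ h].
  have := sqr_ge0 (`|z| - M); rewrite /phi; nra.
have hasE : has_inf E.
  by split; [exists (phi 0), 0|exists (- M ^+ 2) => _ [z _ <-]].
have infE z : inf E <= phi z by apply: (ge_inf hasE.2); exists z.
(* Parallelogram identity, with the midpoint of [y] and [z] tested against the infimum:
   near-minimisers are close to each other. *)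
have par y z : `|y - z| ^+ 2 <= 2 * (phi y - inf E) + 2 * (phi z - inf E).
  have := infE (2^-1 *: (y + z)).
  rewrite /phi norm_sqrB lZ lD normrZ exprMn norm_sqrD ger0_norm; last lra.
  lra.
have /choice[u uP] : forall n : nat, exists z, phi z < inf E + n.+1%:R^-1.
  move=> n; have n0 : 0 < n.+1%:R^-1 :> R by rewrite invr_gt0.
  by have [_ [z _ <-] h] := inf_adherent n0 hasE; exists z.
have cu : cvgn u.
  apply: cauchy_cvg; apply: cauchy_exP => e e0.
  (* Each of the two gaps to the infimum enters [par] with a factor 2, so gaps below [e ^+ 2 / 4]
     give a squared distance below [e ^+ 2]. *)
  have e40 : 0 < e ^+ 2 / 4 by rewrite divr_gt0 // exprn_gt0.
  have [N _ hN] := near_harmonic_lt e40.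
  exists (u N), N => // n /= Nn; have /= h1 := hN n Nn.
  have /= h2 := hN N (leqnn N).
  rewrite -ball_normE /ball_ /= -(@ltr_pXn2r _ 2) ?nnegrE ?(ltW e0) //.
  apply: (le_lt_trans (par (u N) (u n))); have h3 := uP N; have h4 := uP n.
  have aux (a b c d i k : R) : a < i + c -> b < i + d -> c < k / 4 -> d < k / 4 ->
    2 * (a - i) + 2 * (b - i) < k by lra.
  exact: aux h3 h4 h2 h1.
exists (lim (u @ \oo)) => y.
set z := lim _ in cu *.
have lip y1 : l (- y1) = - l y1.
  by have := lZ (-1) y1; rewrite scaleN1r mulN1r.
have phiz : phi z <= inf E.
  have c1 : phi (u n) @[n --> \oo] --> phi z.
    apply: cvgB; first by rewrite expr2; apply: cvgM; apply: cvg_norm.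
    apply: cvgMr; apply/cvgrPdist_le => e e0.
    have M10 : 0 < `|M| + 1 by rewrite ltr_wpDl.
    have : \forall n \near \oo, `|z - u n| < e / (`|M| + 1).
      have/cvgrPdist_lt := cu; apply; exact: divr_gt0.
    apply: filterS => n; rewrite ltr_pdivlMr // => h.
    rewrite -lip -lD; apply: (le_trans (lM _)).
    have := ler_norm M; have := normr_ge0 (z - u n); nra.
  have c2 : inf E + n.+1%:R^-1 @[n --> \oo] --> inf E + 0.
    by apply: cvgD; [exact: cvg_cst|exact: cvg_harmonic].
  rewrite -[leRHS]addr0; apply: (ler_cvg_to c1 c2).
  by near=> n; apply/ltW/uP.
(* Minimality of [z] along the line directed by [y]. For nonzero [y] the optimal [s] chosen below
   forces the linear coefficient to vanish; for [y] of norm 0 the values 1 and -1 suffice. *)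
have key s : 0 <= s ^+ 2 * `|y| ^+ 2 + 2 * s * (ip z y - l y).
  have := infE (z + s *: y); have := phiz.
  rewrite /phi norm_sqrD lD lZ normrZ exprMn real_normK ?num_real // ipZr; lra.
have [y0|y0] := eqVneq (`|y| ^+ 2) 0.
  by have := key 1; have := key (-1); rewrite y0; lra.
have y00 : 0 < `|y| ^+ 2 by rewrite lt0r y0 sqr_ge0.
have := key (- (ip z y - l y) / `|y| ^+ 2).
set d := ip z y - l y; set Y := `|y| ^+ 2 in y0 y00 *.
have -> : (- d / Y) ^+ 2 * Y + 2 * (- d / Y) * d = - (d ^+ 2 / Y) by field.
rewrite oppr_ge0 pmulr_lle0 ?invr_gt0 // => h.
have : d ^+ 2 == 0 by rewrite eq_le h sqr_ge0.
by rewrite sqrf_eq0 subr_eq0 => /eqP.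
Unshelve. all: by end_near.
Qed.

End hilbert.

(** * Monotonicity of absolutely continuous functions *)

Section monotonicity.
Context {R : realType}.
Local Notation mu := (@lebesgue_measure R).

Lemma ae_of_all (P : R -> Prop) : (forall t, P t) -> {ae mu, forall t, P t}.
Proof.
move=> hP; by exists set0; split=> // t /= /(_ (hP t)).
Qed.

Lemma ae_imply (P Q : R -> Prop) : (forall t, P t -> Q t) ->
  {ae mu, forall t, P t} -> {ae mu, forall t, Q t}.
Proof. by move=> PQ; apply: negligibleS => t /= nQ /PQ. Qed.

Lemma ae_imply2 (P1 P2 Q : R -> Prop) : (forall t, P1 t -> P2 t -> Q t) ->
  {ae mu, forall t, P1 t} -> {ae mu, forall t, P2 t} -> {ae mu, forall t, Q t}.
Proof.
move=> PQ h1 h2; have := negligibleU h1 h2; apply: negligibleS => t /= nQ.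
by apply: contrapT => /not_orP[/contrapT p1 /contrapT p2]; apply/nQ/PQ.
Qed.

(** The supremum of the initial segments where [P] holds is reached by the first hypothesis and
    passed by the second. At [c = a] the first premise is vacuous, so it also serves as base case.
    This replaces compactness arguments on segments. *)
Lemma real_induction (P : R -> Prop) (a b : R) :
  (forall c, a <= c <= b -> (forall s, a <= s < c -> P s) -> P c) ->
  (forall c, a <= c < b -> P c ->
    exists2 d, c < d & forall s, c < s <= d -> P s) ->
  forall c, a <= c <= b -> P c.
Proof.
move=> Plim Pstep c /andP[ac cb].
pose S := [set c | a <= c <= b /\ forall s, a <= s <= c -> P s].
have ab : a <= b := le_trans ac cb.
have Sa : S a.
  split=> [|s]; first by rewrite lexx.
  rewrite -eq_le => /eqP <-; apply: Plim => [|s']; first by rewrite lexx.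
  by case/andP => h1 h2; lra.
have supS : has_sup S by split; [exists a|exists b => x [/andP[]]].
pose m := sup S.
have am : a <= m by apply: ub_le_sup => //; exact: supS.2.
have mb : m <= b by apply: ge_sup; [exists a|move=> x [/andP[]]].
have Plt s : a <= s < m -> P s.
  move=> /andP[as_ sm].
  have [x [_ Sx] sx] := sup_gt supS.1 sm.
  by apply: Sx; rewrite as_ ltW.
have Pm : P m by apply: Plim; rewrite ?am.
have Sm : forall s, a <= s <= m -> P s.
  move=> s /andP[as_]; rewrite le_eqVlt => /orP[/eqP-> //|sm].
  by apply: Plt; rewrite as_.
suff mbE : m = b by apply: Sm; rewrite ac mbE.
apply/eqP; rewrite eq_le mb leNgt; apply/negP => mltb.
have [d md Pd] : exists2 d, m < d & forall s, m < s <= d -> P s.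
  by apply: Pstep => //; rewrite am.
pose e := Num.min d b.
have me : m < e by rewrite lt_min md.
have : S e.
  split; first by rewrite (le_trans am (ltW me)) ge_min lexx orbT.
  move=> s /andP[as_ se]; have [sm|ms] := leP s m; first by apply: Sm; rewrite as_.
  by apply: Pd; rewrite ms (le_trans se) // ge_min lexx.
by move/(ub_le_sup supS.2); rewrite leNgt me.
Qed.

Lemma sum_itv_le_measure (U : set R) n (l r : nat -> R) :
  measurable U -> (forall i, (i < n)%N -> l i <= r i /\ `]l i, r i[ `<=` U) ->
  trivIset [set: 'I_n] (fun i : 'I_n => `]l i, r i[%classic) ->
  ((\sum_(i < n) (r i - l i))%:E <= mu U)%E.
Proof.
move=> mU lr tr.
have -> : (\sum_(i < n) (r i - l i))%:E =
    (\sum_(i < n) mu (`]l i, r i[%classic))%E.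
  rewrite -sumEFin; apply: eq_bigr => i _.
  rewrite lebesgue_measure_itv /= lte_fin.
  have [lei _] := lr i (ltn_ord i).
  move: lei; rewrite le_eqVlt => /orP[/eqP->|->]; last by rewrite EFinB.
  by rewrite ltxx subrr.
have <- : mu (\big[setU/set0]_(i < n) `]l i, r i[%classic) =
    (\sum_(i < n) mu (`]l i, r i[%classic))%E.
  by apply: measure_bigsetU_ord_cond => //; exact: sub_trivIset tr.
apply: le_measure; rewrite ?inE //; first exact: bigsetU_measurable.
rewrite -bigcup_seq => x [i /= _]; have [_] := lr i (ltn_ord i); exact.
Qed.


(* Vitali-type argument: off a null set the slopes are small, while the null
   set sits in an open set U of small measure, over which the total increment
   of f is small by absolute continuity.  Intervals inside U are collected from
   left to right. *)
Lemma abs_continuous_nonincreasing (f : R -> R^o) (a b : R) : a <= b ->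
  abs_continuous a b f ->
  {ae mu, forall t, a <= t < b -> forall e, 0 < e ->
    exists2 d, t < d & forall s, t < s <= d -> f s - f t <= e * (s - t)} ->
  f b <= f a.
Proof.
move=> ab acf [N [mN muN0 subN]].
suff main e : 0 < e -> f b - f a <= e * (b - a) + 2 * e.
  apply/ler_addgt0Pl => e e0.
  have ba1 : 0 < b - a + 2 by lra.
  have := main (e / (b - a + 2)) (divr_gt0 e0 ba1).
  by rewrite [2 * _]mulrC -mulrDr divfK ?gt_eqF // lerBlDr.
move=> e0.
have [d d0 acd] := acf _ e0.
have muNoo : (mu N < +oo)%E by rewrite muN0.
have [U [oU NU muU]] := lebesgue_regularity_outer mN muNoo d0.
have mU : measurable U by exact: open_measurable.
have muUd : (mu U < d%:E)%E.
  rewrite -(setDKU NU); apply: (le_lt_trans (measureU2 _ _ _)) => //.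
    exact: measurableD.
  by move: muN0 => /= ->; rewrite adde0.
(* Keeping the intervals ordered from left to right makes disjointness automatic; indexing by [nat]
   lets one append an interval by redefining index [n] only. *)
pose fam (c : R) n (l r : nat -> R) :=
  (forall i, (i < n)%N -> [/\ a <= l i, l i <= r i, r i <= c &
      `]l i, r i[ `<=` U]) /\
  (forall i j, (i < j < n)%N -> r i <= l j).
(* The increments over the collected intervals stay as a sum, bounded by absolute continuity only at
   the very end. The slack [eta] is what allows [P] to pass to a limit from the left. *)
pose P c := forall eta, 0 < eta -> exists n l r, fam c n l r /\
  f c - f a <= e * (c - a) + \sum_(i < n) `|f (r i) - f (l i)| + eta.
have fam_le c c' n l r : c <= c' -> fam c n l r -> fam c' n l r.
  move=> cc' [h1 h2]; split=> // i /h1[? ? ? ?]; split=> //.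
  exact: le_trans cc'.
have fam_tr c n l r : fam c n l r ->
    trivIset [set: 'I_n] (fun i : 'I_n => `]l i, r i[%classic).
  move=> [h1 h2] i j _ _ [x []]; rewrite /= !in_itv /=.
  case/andP => ? ? /andP[? ?]; apply/val_inj => /=.
  case: (ltngtP i j) => // ij.
    have := h2 i j; rewrite ij ltn_ord => /(_ isT) h; exfalso; lra.
  have := h2 j i; rewrite ij ltn_ord => /(_ isT) h; exfalso; lra.
have fam_small n l r : fam b n l r -> \sum_(i < n) `|f (r i) - f (l i)| < e.
  move=> F; apply: (acd n (fun i => l i) (fun i => r i)).
  - by move=> i; have [? ? ? _] := F.1 i (ltn_ord i).
  - exact: fam_tr F.
  - rewrite -lte_fin; apply: le_lt_trans muUd.
    apply: sum_itv_le_measure => //; last exact: fam_tr F.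
    by move=> i /F.1[].
have Pb : P b.
  apply: (@real_induction P a b) => [c /andP[ac cb] Pc|c /andP[ac cb] Pc|].
  - move=> eta eta0; have eta20 : 0 < eta / 2 by rewrite divr_gt0.
    have [ca|ca] := eqVneq c a.
      exists 0, (fun=> 0), (fun=> 0); split; first by split=> // i j; rewrite ltn0 andbF.
      by rewrite big_ord0 ca !subrr; lra.
    have {ca}ac : a < c by rewrite lt_neqAle eq_sym ca.
    have [d1 d10 acd1] := acf _ eta20.
    pose s := Num.max a (c - d1 / 2).
    have as_ : a <= s by rewrite le_max lexx.
    have sc : s < c by rewrite gt_max ac; lra.
    have csd : c - s < d1.
      have : c - d1 / 2 <= s by rewrite le_max lexx orbT.
      lra.
    have [|n [l [r [F1 F2]]]] := Pc s _ _ eta20; first by rewrite as_.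
    exists n, l, r; split; first by apply: fam_le F1; exact: ltW.
    have : \sum_(i < 1) `|f c - f s| < eta / 2.
      apply: (acd1 1%N (fun=> s) (fun=> c)) => [i||].
      - by split => //; exact: ltW.
      - by move=> i j _ _ _; rewrite [i]ord1 [j]ord1.
      - by rewrite big_ord1.
    rewrite big_ord1 ltr_norml => /andP[_ h].
    have : e * (s - a) <= e * (c - a) by rewrite ler_pM2l // lerD2r ltW.
    move: F2; set S := \sum_(i < n) _; lra.
  (* Off [N] the slope hypothesis prolongs the estimate with the same family; on [N] the new stretch
     lies in [U] and is appended as one more interval. *)
  - case: (pselect (N c)) => Nc; last first.
      have := subsetC subN Nc; rewrite setCK /= ac cb.
      move=> /(_ isT e e0)[d' cd' hd']; exists d' => // s cs eta eta0.
      have /andP[cs1 _] := cs.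
      have [n [l [r [F1 F2]]]] := Pc _ eta0; exists n, l, r.
      split; first exact: fam_le (ltW cs1) F1.
      have := hd' s cs; move: F2; set S := \sum_(i < n) _; lra.
    have [g g0 hg] : exists2 g, 0 < g & `]c - g, c + g[ `<=` U.
      have [g /= g0 hg] := (@nbhs_ballP R R c U).1 (open_nbhs_nbhs (conj oU (NU _ Nc))).
      by exists g => // x; rewrite -ball_itv; exact: hg.
    exists (c + g / 2); first by lra.
    move=> s /andP[cs sg] eta eta0.
    have [n [l [r [[F0 F1] F2]]]] := Pc _ eta0.
    exists n.+1, (fun i => if i == n then c else l i),
      (fun i => if i == n then s else r i); split.
      split=> [i|i j /andP[ij]]; rewrite ltnS.
        case: eqP => [_ _|/eqP ni ile].
          split => //; rewrite ?ltW // => x; rewrite /= in_itv /= => /andP[? ?].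
          by apply: hg; rewrite /= in_itv /=; apply/andP; split; lra.
        have [|? ? ? ?] := F0 i; first by rewrite ltn_neqAle ni.
        by split=> //; apply: le_trans (ltW cs).
      move=> jn; have ltin : (i < n)%N by exact: leq_trans jn.
      rewrite (ltn_eqF ltin); case: eqP => [_|/eqP nj].
        by have [] := F0 i ltin.
      by apply: F1; rewrite ij ltn_neqAle nj.
    rewrite big_ord_recr /= eqxx.
    under eq_bigr => i _ do rewrite (ltn_eqF (ltn_ord i)).
    have := ler_norm (f s - f c).
    have : e * (c - a) <= e * (s - a) by rewrite ler_pM2l // lerD2r ltW.
    move: F2; set S := \sum_(i < n) _; lra.
  - by rewrite ab lexx.
have [n [l [r [F1 F2]]]] := Pb _ e0.
have := fam_small _ _ _ F1; move: F2; set S := \sum_(i < n) _; lra.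
Qed.

End monotonicity.

(** * One-sided derivatives *)

Section one_sided_derivative.
Context {R : realType}.
Implicit Types (t s : R).
Local Notation hfilter t := (within `[0, +oo[ (dnbhs (t : R))).

Definition hder {V : normedModType R} (f : R -> V) t (l : V) : Prop :=
  diff_quotients f t --> l.

Lemma near_hfilterP t (P : set R) :
  (\forall s \near hfilter t, P s) <->
  exists2 d, 0 < d & forall s, 0 <= s -> s != t -> `|s - t| < d -> P s.
Proof.
rewrite near_withinE /dnbhs near_withinE near_simpl; split.
  move=> /(nbhs_ballP t) [d /= d0 h]; exists d => // s s0 st std.
  by apply: h => //=; rewrite ?in_itv /= ?s0 // -ball_normE /= distrC.
move=> [d d0 h]; apply/(nbhs_ballP t); exists d => //= s.
rewrite -ball_normE /= => ts st; rewrite in_itv /= andbT => s0.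
by apply: h => //; rewrite distrC.
Qed.

Lemma hfilter_proper t : 0 <= t -> ProperFilter (hfilter t).
Proof.
move=> t0; split; last exact: within_filter.
move=> /near_hfilterP [d d0 /(_ (t + d / 2))]; apply.
- by rewrite addr_ge0 // ltW // divr_gt0.
- by rewrite -subr_eq0 addrC addKr gt_eqF // divr_gt0.
- by rewrite addrC addKr gtr0_norm; lra.
Qed.

Lemma cvg_hfilter_id t : (s @[s --> hfilter t]) --> t.
Proof.
apply/cvgrPdist_lt => e e0; apply/near_hfilterP; exists e => // s _ _.
by rewrite distrC.
Qed.

Section vector_valued.
Context {V : normedModType R}.
Implicit Types f g : R -> V.

Lemma hder_lim f t l : 0 <= t -> hder f t l -> hderiv f t = l.
Proof.
move=> /hfilter_proper tP fl; apply: (@cvg_lim V (@norm_hausdorff _ V) _ _ _ _ l fl).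
Qed.

Lemma hderP f t : 0 <= t -> hderivable f t -> hder f t (hderiv f t).
Proof. by []. Qed.

Lemma eq_hder f g t l : 0 <= t -> (forall s, 0 <= s -> f s = g s) ->
  hder f t l -> hder g t l.
Proof.
move=> t0 fg; apply: cvg_trans; apply: near_eq_cvg; apply/near_hfilterP.
by exists 1 => // s s0 _ _; rewrite !fg.
Qed.

Lemma hder_cvg f t l : hder f t l -> f s @[s --> hfilter t] --> f t.
Proof.
move=> fl.
have h : (s - t) *: ((s - t)^-1 *: (f s - f t)) + f t @[s --> hfilter t] --> f t.
  rewrite -[X in _ --> X]add0r; apply: cvgD; last exact: cvg_cst.
  rewrite -(scale0r l); apply: cvgZ fl; rewrite -[X in _ --> X](subrr t).
  by apply: cvgB; [exact: cvg_hfilter_id|exact: cvg_cst].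
apply: cvg_trans h; apply: near_eq_cvg; apply/near_hfilterP; exists 1 => // s _ st _.
by rewrite scalerA divff ?scale1r ?subrK // subr_eq0.
Qed.

(** A sequential form of the derivative, as needed by Fatou's lemma and by limits of measurable
    functions. *)
Lemma hder_harmonic f t l : 0 <= t -> hder f t l ->
  (n.+1%:R^-1)^-1 *: (f (t + n.+1%:R^-1) - f t) @[n --> \oo] --> l.
Proof.
move=> t0 fl.
have c1 : (t + n.+1%:R^-1 @[n --> \oo]) --> hfilter t.
  move=> P /near_hfilterP[d d0 hd].
  suff : \forall n \near \oo, P (t + n.+1%:R^-1) by [].
  have n0 n : 0 < n.+1%:R^-1 :> R by rewrite invr_gt0.
  apply: filterS (near_harmonic_lt d0) => n /= nd; apply: hd.
  - by rewrite addr_ge0 // ltW.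
  - by rewrite -subr_eq0 addrC addKr gt_eqF.
  - by rewrite addrC addKr gtr0_norm.
have : (t + n.+1%:R^-1 - t)^-1 *: (f (t + n.+1%:R^-1) - f t) @[n --> \oo] --> l.
  exact: cvg_comp _ _ c1 fl.
by under eq_fun do rewrite [t + _ - t]addrC addKr.
Qed.

Lemma hder_cst (c : V) t : hder (fun=> c) t 0.
Proof.
rewrite /hder /diff_quotients; under eq_fun do rewrite subrr scaler0.
exact: cvg_cst.
Qed.

Lemma hderD f g t l m : hder f t l -> hder g t m ->
  hder (fun s => f s + g s) t (l + m).
Proof.
move=> fl gm; rewrite /hder /diff_quotients.
under eq_fun do rewrite opprD addrACA scalerDr.
exact: cvgD.
Qed.

Lemma hderZ f (k : R) t l : hder f t l -> hder (fun s => k *: f s) t (k *: l).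
Proof.
move=> fl; rewrite /hder /diff_quotients.
under eq_fun do rewrite -scalerBr scalerA mulrC -scalerA.
exact: cvgZr.
Qed.

Lemma hderB f g t l m : hder f t l -> hder g t m ->
  hder (fun s => f s - g s) t (l - m).
Proof.
move=> fl gm; rewrite -scaleN1r.
have -> : (fun s => f s - g s) = (fun s => f s + (-1) *: g s).
  by apply/funext => s; rewrite scaleN1r.
by apply: hderD => //; exact: hderZ.
Qed.

End vector_valued.

Lemma hderM (f g : R -> R^o) t (l m : R^o) : hder f t l -> hder g t m ->
  hder (fun s => f s * g s : R^o) t (l * g t + f t * m).
Proof.
move=> fl gm; rewrite /hder /diff_quotients.
rewrite (_ : (fun s => _) = fun s => ((s - t)^-1 *: (f s - f t)) * g s +
   f t * ((s - t)^-1 *: (g s - g t))).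
  by apply: cvgD; [apply: cvgM => //; exact: hder_cvg gm|exact: cvgMr].
by apply/funext => s; rewrite /GRing.scale /=; ring.
Qed.

Lemma hder_ip {H : completeNormedModType R} (ip : {dot H for idfun})
    (ip_norm : induces_norm ip) (f g : R -> H) t l m :
  hder f t l -> hder g t m ->
  hder (fun s => ip (f s) (g s) : R^o) t (ip l (g t) + ip (f t) m).
Proof.
move=> fl gm; rewrite /hder /diff_quotients.
rewrite (_ : (fun s => _) = fun s => ip ((s - t)^-1 *: (f s - f t)) (g s) +
   ip (f t) ((s - t)^-1 *: (g s - g t))).
  apply: cvgD; first by apply: cvg_ip => //; exact: hder_cvg gm.
  by apply: cvg_ip => //; exact: cvg_cst.
by apply/funext => s; rewrite ipZl ipZr !ipE /GRing.scale /=; ring.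
Qed.

Lemma derivable_hder (f : R -> R^o) t : derivable f t 1 -> hder f t ('D_1 f t).
Proof.
rewrite /hder /diff_quotients => fd.
apply/cvgrPdist_lt => e e0; apply/near_hfilterP.
have /cvgrPdist_lt/(_ e e0) := fd.
move=> /(nbhs_ballP (0 : R)) [d /= d0 h].
exists d => // s s0 st std.
have := h (s - t); rewrite -ball_normE /= sub0r normrN std => /(_ isT).
by rewrite subr_eq0 st => /(_ isT); rewrite /GRing.scale /= mulr1 subrK.
Qed.

Lemma hder_slope (f : R -> R^o) t (l : R^o) e : 0 <= t -> hder f t l -> l <= 0 ->
  0 < e -> exists2 d, t < d & forall s, t < s <= d -> f s - f t <= e * (s - t).
Proof.
move=> t0 /cvgrPdist_lt fl l0 e0.
have /near_hfilterP[d d0 h] := fl _ e0.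
exists (t + d / 2); first by lra.
move=> s /andP[ts sd].
have st0 : 0 < s - t by rewrite subr_gt0.
have := h s; rewrite gt_eqF // gtr0_norm // => /(_ _ isT).
have s0 : 0 <= s by lra.
have std : s - t < d by lra.
move=> /(_ s0 std); rewrite ltr_norml => /andP[+ _].
rewrite /GRing.scale /= => h'.
have h2 : (s - t)^-1 * (f s - f t) <= e by lra.
by rewrite mulrC in h2; rewrite -ler_pdivrMr.
Qed.

Lemma hder_nonincreasing (f : R -> R^o) : locally_abs_continuous f ->
  {ae (@lebesgue_measure R), forall t, 0 <= t -> exists2 l : R^o, hder f t l & l <= 0} ->
  forall s t, 0 <= s -> s <= t -> f t <= f s.
Proof.
move=> acf aef s t s0 st.
have [t0|t0] := leP t 0; first by have -> : t = s by lra.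
apply: abs_continuous_nonincreasing => //.
  move=> e e0; have [d d0 h] := acf t t0 e e0; exists d => // n l r lr.
  by apply: h => i; have [h1 h2 h3] := lr i; split => //; exact: le_trans h1.
apply: ae_imply aef => x hx /andP[sx xt] e e0.
have x0 : 0 <= x by exact: le_trans sx.
by have [l fl l0] := hx x0; exact: hder_slope fl _ _.
Qed.

End one_sided_derivative.

(** * Absolute continuity and primitives *)

Section absolutely_continuous_functions.
Context {R : realType}.
Local Notation mu := (@lebesgue_measure R).

Lemma continuous_bounded_itv {V : normedModType R} (f : R -> V) (a b : R) :
  continuous f -> exists2 M, 0 <= M & forall s, a <= s <= b -> `|f s| <= M.
Proof.
move=> cf; have cK : compact (f @` `[a, b]).
  by apply: continuous_compact; [exact: continuous_subspaceT|exact: segment_compact].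
have [M [_ hM]] := compact_bounded cK; exists (`|M| + 1) => // s asb.
apply: (hM (`|M| + 1)); first by have := ler_norm M; lra.
by exists s => //=; rewrite in_itv.
Qed.

Lemma near_dist_lt (t e : R) : 0 < e -> \forall s \near t, `|t - s| < e.
Proof. by move=> e0; have /cvgrPdist_lt := @cvg_id _ (nbhs t); exact. Qed.

(* Precomposing with [clamp0] turns a function continuous on [0, +oo[ into one
   continuous on R, to which the library's integration lemmas apply. *)
Definition clamp0 (t : R) : R := Num.max 0 t.

Lemma clamp0_ge0 t : 0 <= clamp0 t. Proof. by rewrite le_max lexx. Qed.

Lemma clamp0_id t : 0 <= t -> clamp0 t = t.
Proof. by move=> t0; rewrite /clamp0 max_r. Qed.

Lemma clamp0_dist s t : `|clamp0 s - clamp0 t| <= `|s - t|.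
Proof.
rewrite /clamp0 /Order.max; case: ltP => hs; case: ltP => ht //.
- rewrite subr0 !gtr0_norm //; lra.
- rewrite sub0r normrN distrC !gtr0_norm //; lra.
- by rewrite subrr normr0.
Qed.

Lemma continuous_clamp0 : continuous clamp0.
Proof.
move=> t; apply/cvgrPdist_lt => e e0; near=> s.
apply: le_lt_trans (clamp0_dist _ _) _; near: s.
exact: near_dist_lt.
Unshelve. all: by end_near. Qed.

Lemma positive_continuous_clamp0 (f : R -> R) :
  positive_continuous f -> continuous (f \o clamp0).
Proof.
move=> [_ cf] t; apply/cvgrPdist_lt => e e0.
have b0 : 0 < clamp0 t + 1 by have := clamp0_ge0 t; lra.
have /subspace_continuousP/(_ (clamp0 t)) := cf _ b0.
have tb : `[0, clamp0 t + 1]%classic (clamp0 t).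
  by rewrite /= in_itv /= clamp0_ge0; lra.
move=> /(_ tb) /cvgrPdist_lt/(_ _ e0).
rewrite /prop_near1 /within /= => h.
have h1 : \forall s \near t, `[0, clamp0 t + 1]%classic (clamp0 s) ->
    `|f (clamp0 t) - f (clamp0 s)| < e by exact: (continuous_clamp0 h).
near=> s; suff : `[0, clamp0 t + 1]%classic (clamp0 s) by near: s; exact: h1.
rewrite /= in_itv /= clamp0_ge0 /=.
have : `|t - s| < 1 by near: s; exact: near_dist_lt.
have := clamp0_dist s t; rewrite [`|s - t|]distrC.
have := ler_norm (clamp0 s - clamp0 t); lra.
Unshelve. all: by end_near. Qed.

Section vector_valued.
Context {V : normedModType R}.
Implicit Types f : R -> V.

Lemma lac_continuous_clamp0 f : locally_abs_continuous f ->
  continuous (f \o clamp0).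
Proof.
move=> acf t; apply/cvgrPdist_lt => e e0.
have b0 : 0 < clamp0 t + 1 by have := clamp0_ge0 t; lra.
have [d d0 hd] := acf _ b0 _ e0.
have key l r : 0 <= l -> l <= r -> r <= clamp0 t + 1 -> r - l < d ->
    `|f r - f l| < e.
  move=> l0 lr rb rl; have := hd 1%N (fun=> l) (fun=> r).
  rewrite !big_ord1; apply => // [i j _ _ _]; by rewrite [i]ord1 [j]ord1.
near=> s.
have s1 : `|t - s| < 1 by near: s; exact: near_dist_lt.
have sd : `|t - s| < d by near: s; exact: near_dist_lt.
rewrite /=; have := clamp0_dist t s; have := clamp0_ge0 t; have := clamp0_ge0 s.
move: (clamp0 t) (clamp0 s) key => p q key q0 p0 pq.
case: (leP p q) => h.
  have {}pq : q - p <= `|t - s| by rewrite distrC in pq; exact: le_trans (ler_norm _) pq.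
  rewrite distrC; apply: key => //; lra.
have {}pq : p - q <= `|t - s| by exact: le_trans (ler_norm _) pq.
by apply: key => //; lra.
Unshelve. all: by end_near. Qed.

Lemma lac_bounded f b : locally_abs_continuous f ->
  exists2 M, 0 <= M & forall s, 0 <= s <= b -> `|f s| <= M.
Proof.
move=> /lac_continuous_clamp0 /(@continuous_bounded_itv V _ 0 b)[M M0 hM].
exists M => // s s0b; have := hM s s0b; rewrite /= clamp0_id //.
by case/andP: s0b.
Qed.

Lemma lac_lipschitz f :
  (forall b, 0 < b -> exists M, forall l r, 0 <= l -> l <= r -> r <= b ->
    `|f r - f l| <= M * (r - l)) -> locally_abs_continuous f.
Proof.
move=> fM b b0 e e0; have [M hM] := fM b b0.
have M0 : 0 < `|M| + 1 by have := normr_ge0 M; lra.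
exists (e / (`|M| + 1)); first exact: divr_gt0.
move=> n l r lr _; rewrite ltr_pdivlMr // => h.
apply: le_lt_trans h; rewrite mulr_suml; apply: ler_sum => i _.
have [l0 lri rb] := lr i.
apply: (le_trans (hM _ _ l0 lri rb)); rewrite mulrC ler_wpM2l ?subr_ge0 //.
by have := ler_norm M; lra.
Qed.

(** Common source of the closure properties: on a compact interval the increments of a sum, product
    or inner product are controlled by those of its two arguments. *)
Lemma lac_dominated {V1 V2 : normedModType R} f (g : R -> V1) (k : R -> V2) :
  locally_abs_continuous g -> locally_abs_continuous k ->
  (forall b, 0 < b -> exists M, forall l r, 0 <= l -> l <= r -> r <= b ->
    `|f r - f l| <= M * (`|g r - g l| + `|k r - k l|)) ->
  locally_abs_continuous f.
Proof.
move=> acg ack fM b b0 e e0; have [M hM] := fM b b0.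
have M0 : 0 < `|M| + 1 by have := normr_ge0 M; lra.
pose e' := e / (`|M| + 1) / 2.
have e'0 : 0 < e' by rewrite divr_gt0 // divr_gt0.
have [d1 d10 h1] := acg b b0 _ e'0.
have [d2 d20 h2] := ack b b0 _ e'0.
exists (Num.min d1 d2); first by rewrite lt_min d10.
move=> n l r lr tr; rewrite lt_min => /andP[s1 s2].
have {}h1 := h1 n l r lr tr s1; have {}h2 := h2 n l r lr tr s2.
have eE : e = (`|M| + 1) * (e' + e').
  by rewrite -splitr mulrC divfK // gt_eqF.
rewrite eE; apply: (@le_lt_trans _ _ ((`|M| + 1) * (\sum_(i < n) `|g (r i) - g (l i)|
   + \sum_(i < n) `|k (r i) - k (l i)|))).
  rewrite -big_split /= mulr_sumr; apply: ler_sum => i _.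
  have [l0 lri rb] := lr i.
  apply: (le_trans (hM _ _ l0 lri rb)); rewrite ler_wpM2r ?addr_ge0 //.
  by have := ler_norm M; lra.
by rewrite ltr_pM2l // ltrD.
Qed.

End vector_valued.

Lemma lac_cst {V : normedModType R} (c : V) :
  locally_abs_continuous (fun _ : R => c).
Proof.
by apply: lac_lipschitz => b _; exists 0 => l r _ _ _; rewrite subrr normr0 mul0r.
Qed.

Lemma lacD {V : normedModType R} (f g : R -> V) :
  locally_abs_continuous f -> locally_abs_continuous g ->
  locally_abs_continuous (fun t => f t + g t).
Proof.
move=> acf acg; apply: (lac_dominated acf acg) => b _; exists 1 => l r _ _ _.
by rewrite mul1r opprD addrACA ler_normD.
Qed.

Lemma lacB {V : normedModType R} (f g : R -> V) :
  locally_abs_continuous f -> locally_abs_continuous g ->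
  locally_abs_continuous (fun t => f t - g t).
Proof.
move=> acf acg; apply: (lac_dominated acf acg) => b _; exists 1 => l r _ _ _.
by rewrite mul1r opprD addrACA -opprD; apply: ler_normB.
Qed.

Lemma lacM (f g : R -> R^o) :
  locally_abs_continuous f -> locally_abs_continuous g ->
  locally_abs_continuous (fun t => f t * g t : R^o).
Proof.
move=> acf acg; apply: (lac_dominated acf acg) => b b0.
have [M M0 hM] := lac_bounded b acf; have [N N0 hN] := lac_bounded b acg.
exists (M + N) => l r l0 lr rb.
have -> : f r * g r - f l * g l = (f r - f l) * g r + f l * (g r - g l) by ring.
apply: (le_trans (ler_normD _ _)); rewrite !normrM.
have := hM l; rewrite l0 (le_trans lr rb) => /(_ isT).
have := hN r; rewrite rb (le_trans l0 lr) => /(_ isT).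
have := normr_ge0 (f r - f l); have := normr_ge0 (g r - g l); nra.
Qed.

Lemma lac_ip {H : completeNormedModType R} (ip : {dot H for idfun})
    (ip_norm : induces_norm ip) (f g : R -> H) :
  locally_abs_continuous f -> locally_abs_continuous g ->
  locally_abs_continuous (fun t => ip (f t) (g t) : R^o).
Proof.
move=> acf acg; apply: (lac_dominated acf acg) => b b0.
have [M M0 hM] := lac_bounded b acf; have [N N0 hN] := lac_bounded b acg.
exists (M + N) => l r l0 lr rb.
have -> : ip (f r) (g r) - ip (f l) (g l) =
    ip (f r - f l) (g r) + ip (f l) (g r - g l) by rewrite !ipE; ring.
apply: (le_trans (ler_normD _ _)).
have := ip_normM ip_norm (f r - f l) (g r).
have := ip_normM ip_norm (f l) (g r - g l).
have := hM l; rewrite l0 (le_trans lr rb) => /(_ isT).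
have := hN r; rewrite rb (le_trans l0 lr) => /(_ isT).
have := normr_ge0 (f r - f l); have := normr_ge0 (g r - g l); nra.
Qed.

End absolutely_continuous_functions.

Section primitives.
Context {R : realType}.
Local Notation mu := (@lebesgue_measure R).
Implicit Types f g : R -> R.

Definition prim f (t : R) : R := \int[mu]_(s in `[0, t]) f s.

Lemma continuous_integrable_itv f a b : continuous f ->
  mu.-integrable `[a, b] (EFin \o f).
Proof.
move=> cf; apply: continuous_compact_integrable; first exact: segment_compact.
exact: continuous_subspaceT.
Qed.

Lemma prim0 f : prim f 0 = 0.
Proof. by rewrite /prim set_itv1 Rintegral_set1. Qed.

Lemma primD f g t : continuous f -> continuous g ->
  prim (fun s => f s + g s) t = prim f t + prim g t.
Proof. by move=> cf cg; apply: RintegralD => //; exact: continuous_integrable_itv. Qed.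

Lemma primB f g t : continuous f -> continuous g ->
  prim (fun s => f s - g s) t = prim f t - prim g t.
Proof. by move=> cf cg; apply: RintegralB => //; exact: continuous_integrable_itv. Qed.

Lemma primZ f k t : continuous f -> prim (fun s => k * f s) t = k * prim f t.
Proof. by move=> cf; apply: RintegralZl => //; exact: continuous_integrable_itv. Qed.

Lemma le_prim f g t : continuous f -> continuous g ->
  (forall s, 0 <= s <= t -> f s <= g s) -> prim f t <= prim g t.
Proof.
move=> cf cg fg; apply: le_Rintegral => //; try exact: continuous_integrable_itv.
Qed.

Lemma primB_itv f s t : continuous f -> 0 <= s -> s <= t ->
  prim f t - prim f s = \int[mu]_(x in `]s, t]) f x.
Proof.
move=> cf s0 st; apply: Rintegral_itvB; rewrite ?bnd_simp //.
exact: continuous_integrable_itv.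
Qed.

Lemma prim_incr_le f (s t M : R) : continuous f -> 0 <= s -> s <= t ->
  (forall x, s <= x <= t -> f x <= M) -> prim f t - prim f s <= M * (t - s).
Proof.
move=> cf s0 st fM; rewrite primB_itv //.
have sub : `]s, t] `<=` `[s, t].
  by move=> x /=; rewrite !in_itv /= => /andP[/ltW-> ->].
have muE : fine (mu `]s, t]) = t - s.
  rewrite lebesgue_measure_itv /= lte_fin.
  case: ltP => //= ts; have -> : t = s by lra.
  by rewrite subrr.
have -> : M * (t - s) = \int[mu]_(x in `]s, t]) M.
  by rewrite -muE Rintegral_cst.
apply: le_Rintegral => //.
- by apply: integrableS (continuous_integrable_itv s t cf).
- by apply: integrableS (continuous_integrable_itv s t (fun x => cvg_cst _)).
- by move=> x /=; rewrite in_itv /= => /andP[sx xt]; apply: fM; rewrite ltW.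
Qed.

Lemma prim_incr_ge f (s t M : R) : continuous f -> 0 <= s -> s <= t ->
  (forall x, s <= x <= t -> M <= f x) -> M * (t - s) <= prim f t - prim f s.
Proof.
move=> cf s0 st fM.
have cNf : continuous (fun x => -1 * f x) by move=> x; apply: cvgMr; exact: cf.
have := @prim_incr_le (fun x => -1 * f x) s t (- M) cNf s0 st.
rewrite !primZ // => h; have {}h : -1 * prim f t - -1 * prim f s <= - M * (t - s).
  by apply: h => x /fM; rewrite mulN1r lerN2.
lra.
Qed.

Lemma prim_dist f (s t M : R) : continuous f -> 0 <= s -> s <= t ->
  (forall x, s <= x <= t -> `|f x| <= M) -> `|prim f t - prim f s| <= M * (t - s).
Proof.
move=> cf s0 st fM; rewrite ler_norml -mulNr.
rewrite prim_incr_ge ?prim_incr_le // => x /fM; rewrite ler_norml => /andP[] //.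
Qed.

Lemma prim_lac f : continuous f -> locally_abs_continuous (prim f : R -> R^o).
Proof.
move=> cf; apply: lac_lipschitz => b b0.
have [M M0 hM] := continuous_bounded_itv 0 b (cf : continuous (f : R -> R^o)).
exists M => l r l0 lr rb; apply: prim_dist => // x /andP[lx xr].
by apply: hM; rewrite (le_trans l0) // (le_trans xr).
Qed.

Lemma prim_hder f t : continuous f -> 0 < t -> hder (prim f : R -> R^o) t (f t).
Proof.
move=> cf t0.
have [|pd pE] := @continuous_FTC1_closed R f 0 t (t + 1) _
  (continuous_integrable_itv _ _ cf) t0 (cf t); first by rewrite ltrDl.
by rewrite -pE derive1E; exact: derivable_hder.
Qed.

(** The point 0, left out by [prim_hder], is a null set. *)
Lemma ae_gt0 (P : R -> Prop) : (forall t, 0 < t -> P t) ->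
  {ae mu, forall t, 0 <= t -> P t}.
Proof.
move=> hP; exists [set 0]; split => //; first by rewrite lebesgue_measure_set1.
move=> t /= /not_implyP[t0 nP]; apply/eqP; rewrite eq_le t0 andbT leNgt.
by apply/negP => /hP.
Qed.

(** Stands in for the fundamental theorem of calculus: subtracting a primitive turns an upper bound
    on the derivative into a sign, so the derivative itself is never integrated. *)
Lemma hder_le_prim (f : R -> R^o) Q : locally_abs_continuous f -> continuous Q ->
  {ae mu, forall t, 0 <= t -> exists2 l : R^o, hder f t l & l <= Q t} ->
  forall s t, 0 <= s -> s <= t -> f t - prim Q t <= f s - prim Q s.
Proof.
move=> acf cQ aef; apply: (@hder_nonincreasing R (fun t => f t - prim Q t : R^o)).
  by apply: lacB => //; exact: prim_lac.
have := ae_gt0 (fun t => @prim_hder Q t cQ); move: aef; apply: ae_imply2.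
move=> t h1 h2 t0; have [l fl lQ] := h1 t0; exists (l - Q t).
  exact: hderB fl (h2 t0).
by rewrite subr_le0.
Qed.

End primitives.

(** * Integrals over the half-line *)

Section half_line_integrals.
Context {R : realType}.
Local Notation mu := (@lebesgue_measure R).

Import HBNNSimple.

(** The integral of a nonnegative function is a supremum over the simple functions below it; cutting
    such a simple function off on a null set does not change its integral and places it below
    [g]. *)
Lemma ae_ge0_le_integral_nonmeasurable (D : set R) (f g : R -> \bar R) :
  (forall x, D x -> 0 <= f x)%E -> (forall x, D x -> 0 <= g x)%E ->
  {ae mu, forall x, D x -> (f x <= g x)%E} ->
  (\int[mu]_(x in D) f x <= \int[mu]_(x in D) g x)%E.
Proof.
move=> f0 g0 [N [mN muN0 subN]].
rewrite ge0_integralE // ge0_integralE //.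
apply: ge_ereal_sup => _ [h /= hf <-].
have mCN : measurable (~` N) by exact: measurableC.
have -> : sintegral mu h = sintegral mu (h \_ (~` N)).
  rewrite -integral_nnsfun // -integralT_nnsfun.
  rewrite (ge0_negligible_integral mN) ?setTD //.
  - by apply/measurable_EFinP; exact: measurable_funP.
  - by move=> x _; rewrite lee_fin.
apply: ereal_sup_ubound; exists (proj_nnsfun h mCN).
  move=> x; rewrite -mrestrict.
  rewrite !patchE; case: ifPn => [|_].
    move/set_mem => /= Nx; have := hf x; rewrite patchE; case: ifPn => // xD hfx.
    apply: (le_trans hfx); move: Nx; apply: contra_notP => fg; apply: subN.
    by move=> /(_ (set_mem xD)).
  by case: ifPn => // /set_mem; exact: g0.
by rewrite -mrestrict.
Qed.


Lemma nonincreasing_cvg_pinfty (f : R -> R) (m : R) :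
  (forall s t, 0 <= s -> s <= t -> f t <= f s) -> (forall t, 0 <= t -> m <= f t) ->
  cvg (f t @[t --> +oo]).
Proof.
move=> fd fm; pose S := f @` `[0, +oo[.
have hS : has_inf S.
  split; first by exists (f 0), 0 => //; rewrite /= in_itv /= lexx.
  by exists m => y [t /=]; rewrite in_itv /= andbT => t0 <-; exact: fm.
apply/cvg_ex; exists (inf S); apply/cvgrPdist_le => e e0.
have [y [s /=]] := inf_adherent e0 hS; rewrite in_itv /= andbT => s0 <- fs.
near=> t; have st : s <= t by near: t; apply: nbhs_pinfty_ge; exact: num_real.
have h1 := fd _ _ s0 st.
have h2 : inf S <= f t.
  by apply: (ge_inf hS.2); exists t => //; rewrite /= in_itv /= (le_trans s0).
rewrite ler0_norm; lra.
Unshelve. all: by end_near. Qed.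

Lemma measurable_half_line : measurable (`[0, +oo[ : set R).
Proof. exact: measurable_itv. Qed.

Lemma prim_integralE (f : R -> R) t : continuous f ->
  (prim f t)%:E = (\int[mu]_(s in `[0%R, t]) (f s)%:E)%E.
Proof.
by move=> cf; rewrite fineK //; apply: integrable_fin_num => //;
   exact: continuous_integrable_itv.
Qed.

Lemma prim_le_integral (f : R -> R) t : (forall s, 0 <= s -> 0 <= f s) ->
  continuous f ->
  ((prim f t)%:E <= \int[mu]_(s in `[0%R, +oo[) (f s)%:E)%E.
Proof.
move=> f0 cf; rewrite prim_integralE //; apply: ge0_subset_integral => //.
- by apply/measurable_EFinP; apply: measurable_funTS; exact: continuous_measurable_fun.
- by move=> s /=; rewrite in_itv /= andbT lee_fin; exact: f0.
- by apply: subset_itvl; rewrite bnd_simp.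
Qed.

Lemma prim_nondecreasing (f : R -> R) s t : (forall s, 0 <= s -> 0 <= f s) ->
  continuous f -> 0 <= s -> s <= t -> prim f s <= prim f t.
Proof.
move=> f0 cf s0 st; rewrite -subr_ge0 -[leLHS](mul0r (t - s)).
by apply: prim_incr_ge => // x /andP[sx _]; apply: f0; exact: le_trans sx.
Qed.

Lemma continuous_shift {V : normedModType R} (f : R -> V) (c : R) :
  continuous f -> continuous (fun s => f (s + c)).
Proof.
move=> cf s; apply: (@continuous_comp _ _ _ (fun s => s + c) f); last exact: cf.
by apply: cvgD; [exact: cvg_id|exact: cvg_cst].
Qed.

(* The left-hand sides are integrals of difference quotients, to which Fatou's
   lemma applies; a shift of the primitive turns them into boundary terms. *)
Lemma prim_diff_quotient_le (f : R -> R) (c m t : R) : continuous f -> 0 < c ->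
  0 <= t -> (forall s, 0 <= s -> m <= f s <= f 0) ->
  prim (fun s => c^-1 * (f s - f (s + c))) t <= f 0 - m.
Proof.
move=> cf c0 t0 fb.
have cfc : continuous (fun s => f (s + c)).
  exact: continuous_shift.
have cd : continuous (fun s => f s - f (s + c)).
  by move=> s; apply: cvgB; [exact: cf|exact: cfc].
rewrite primZ // primB //.
have shiftE : prim (fun s => f (s + c)) t = prim f (t + c) - prim f c.
  (* The difference of the two primitives has derivative 0. Taking [k] equal to 1 and to -1 makes
     the monotonicity criterion yield constancy. *)
  pose g k s : R^o := k * (prim f (s + c) - prim (fun s => f (s + c)) s).
  have lacg k : locally_abs_continuous (g k).
    apply: (lacM (lac_cst (k : R^o))); apply: lacB; last exact: prim_lac.
    apply: lac_lipschitz => b b0.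
    have [M M0 hM] := continuous_bounded_itv 0 (b + c) (cf : continuous (f : R -> R^o)).
    exists M => l r l0 lr rb; rewrite (_ : r - l = (r + c) - (l + c)); last by ring.
    apply: prim_dist => //; [by lra|by lra|move=> x /andP[? ?]; apply: hM; lra].
  have hg k : {ae mu, forall t, 0 <= t -> exists2 l : R^o, hder (g k) t l & l <= 0}.
    apply: ae_gt0 => s s0; exists 0 => //.
    have h1 : hder (fun s => prim f (s + c) : R^o) s (f (s + c)).
      have sc0 : 0 < s + c by lra.
      have := prim_hder cf sc0; rewrite /hder /diff_quotients.
      move=> /cvgrPdist_lt h; apply/cvgrPdist_lt => e e0.
      have /near_hfilterP[d d0 hd] := h e e0; apply/near_hfilterP; exists d => // x x0 xs xd.
      have := hd (x + c); rewrite opprD addrACA subrr addr0; apply => //; first by lra.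
      by apply: contraNneq xs => /addIr ->.
    have := hderM (hder_cst (k : R^o) s) (hderB h1 (prim_hder cfc s0)).
    by rewrite subrr mulr0 mul0r addr0.
  have := hder_nonincreasing (lacg 1) (hg 1) (lexx 0) t0.
  have := hder_nonincreasing (lacg (-1)) (hg (-1)) (lexx 0) t0.
  rewrite /g prim0 add0r; lra.
rewrite shiftE ler_pdivrMl //.
have h1 : prim f c - prim f 0 <= f 0 * (c - 0).
  by apply: prim_incr_le => // [|s /andP[s0 _]]; [exact: ltW|have /andP[] := fb _ s0].
have h2 : m * (t + c - t) <= prim f (t + c) - prim f t.
  apply: prim_incr_ge => // [|s /andP[ts _]]; first by lra.
  by have /andP[] := fb s (le_trans t0 ts).
move: h1; rewrite prim0; lra.
Qed.

End half_line_integrals.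

(** * Dissipation of a Lyapunov function *)

Section energy.
Context {R : realType}.
Local Notation mu := (@lebesgue_measure R).

Lemma limn_einf_le (u : (\bar R)^nat) (M : \bar R) :
  (forall n, u n <= M)%E -> (limn_einf u <= M)%E.
Proof.
move=> uM; rewrite limn_einf_lim; apply: lime_le; first exact: is_cvg_einfs.
apply: nearW => n; apply: le_trans (uM n).
by apply: ereal_inf_lbound; exists n => /=.
Qed.

(* Fatou's lemma bounds the integral of minus the derivative of a nonincreasing
   function, whose measurability need not be known. *)
Lemma integral_slope_lty (f : R -> R^o) (a : R -> R) (m : R) :
  locally_abs_continuous f ->
  (forall s t, 0 <= s -> s <= t -> f t <= f s) -> (forall t, 0 <= t -> m <= f t) ->
  (forall t, 0 <= t -> 0 <= a t) ->
  {ae mu, forall t, 0 <= t -> exists2 l : R^o, hder f t l & a t <= - l} ->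
  (\int[mu]_(t in `[0%R, +oo[) (a t)%:E < +oo)%E.
Proof.
move=> acf fd fm a0 aef.
pose g := (f \o clamp0) : R -> R.
have cg : continuous g := lac_continuous_clamp0 acf.
pose q n s := (n.+1%:R^-1)^-1 * (g s - g (s + n.+1%:R^-1)).
have cq n : continuous (q n).
  move=> s; apply: cvgMr; apply: cvgB; first exact: cg.
  exact: (@continuous_shift R R^o g n.+1%:R^-1 cg).
have n0 n : 0 < n.+1%:R^-1 :> R by rewrite invr_gt0.
have q0 n s : 0 <= s -> 0 <= q n s.
  move=> s0; have h := ltW (n0 n).
  rewrite /q mulr_ge0 ?invr_ge0 // subr_ge0 /g /= !clamp0_id ?addr_ge0 //.
  by apply: fd => //; rewrite lerDl.
(* The cut-off at [n] reduces the integral to a primitive on a compact interval; at each fixed time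
   it is eventually inactive, so the pointwise limit is unaffected. *)
pose F n : R -> \bar R := (EFin \o q n) \_ `[0, n%:R].
have mF n : measurable_fun (`[0, +oo[ : set R) (F n).
  apply: measurable_funTS; apply: (measurable_restrictT _ _).1 => //.
  apply/measurable_EFinP; apply: measurable_funTS; exact: continuous_measurable_fun.
have F0 n s : `[0, +oo[%classic s -> (0 <= F n s)%E.
  rewrite /= in_itv /= andbT => s0; rewrite /F patchE; case: ifP => // _.
  by rewrite lee_fin; exact: q0.
have bF n : (\int[mu]_(s in `[0%R, +oo[) F n s <= (f 0 - m)%:E)%E.
  rewrite -integral_mkcondr.
  have -> : `[0%R, +oo[%classic `&` `[0%R, n%:R]%classic = `[0, n%:R]%classic :> set R.
    by apply: setIidr; apply: subset_itvl; rewrite bnd_simp.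
  rewrite -prim_integralE // lee_fin.
  have -> : f 0 = g 0 by rewrite /g /= clamp0_id.
  apply: prim_diff_quotient_le => // s s0; rewrite /g /= !clamp0_id //.
  by rewrite fm //= fd.
apply: (@le_lt_trans _ _ (f 0 - m)%:E); last exact: ltry.
apply: le_trans (limn_einf_le bF).
apply: le_trans (fatou mu measurable_half_line mF F0).
apply: ae_ge0_le_integral_nonmeasurable.
- by move=> s /=; rewrite in_itv /= andbT lee_fin; exact: a0.
- move=> s Ds; rewrite limn_einf_lim; apply: lime_ge; first exact: is_cvg_einfs.
  by apply: nearW => n; apply: le_ereal_inf_tmp => _ [k _ <-]; exact: F0.
apply: ae_imply aef => t h; rewrite /= in_itv /= andbT => t0.
have [l fl al] := h t0.
suff cF : F n t @[n --> \oo] --> (- l)%:E.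
  by rewrite is_cvg_limn_einfE; [rewrite (cvg_lim _ cF) // lee_fin|apply/cvg_ex; exists (- l)%:E].
have cq1 : q n t @[n --> \oo] --> - l.
  have c2 : - ((n.+1%:R^-1)^-1 *: (f (t + n.+1%:R^-1) - f t)) @[n --> \oo] --> - l.
    by apply: cvgN; exact: hder_harmonic.
  apply: cvg_trans c2; apply: near_eq_cvg; apply: nearW => n /=.
  rewrite /q /g /= !clamp0_id ?addr_ge0 ?(ltW (n0 n)) //.
  by rewrite -scalerN opprB.
have c3 : (q n t)%:E @[n --> \oo] --> (- l)%:E by apply: cvg_EFin => //; exact: nearW.
apply: cvg_trans c3; apply: near_eq_cvg; near=> n.
rewrite /F patchE ifT //; apply/mem_set; rewrite /= in_itv /= t0 /=.
near: n; exact: nbhs_infty_ger.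
Unshelve. all: by end_near. Qed.

(** [E - prim Q] is nonincreasing and bounded below by minus the total integral of [Q], so it
    converges, as does [prim Q]; [integral_slope_lty] applied to this difference then controls
    [a]. *)
Lemma energy_dissipation (E : R -> R^o) (Q a : R -> R) :
  locally_abs_continuous E -> (forall t, 0 <= t -> 0 <= E t) ->
  continuous Q -> (forall t, 0 <= t -> 0 <= Q t) ->
  (\int[mu]_(t in `[0%R, +oo[) (Q t)%:E < +oo)%E ->
  (forall t, 0 <= t -> 0 <= a t) ->
  {ae mu, forall t, 0 <= t -> exists2 l : R^o, hder E t l & l + a t <= Q t} ->
  [/\ cvg (E t @[t --> +oo]),
      (\int[mu]_(t in `[0%R, +oo[) (a t)%:E < +oo)%E
    & exists M, forall t, 0 <= t -> E t <= M].
Proof.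
move=> acE E0 cQ Q0 Qoo a0 aeE.
pose I := fine (\int[mu]_(t in `[0%R, +oo[) (Q t)%:E)%E.
have IE : (\int[mu]_(t in `[0%R, +oo[) (Q t)%:E)%E = I%:E.
  rewrite fineK // ge0_fin_numE //; apply: integral_ge0 => t /=.
  by rewrite in_itv /= andbT lee_fin; exact: Q0.
have QI t : prim Q t <= I.
  by rewrite -lee_fin -IE; exact: prim_le_integral.
pose psi t : R^o := E t - prim Q t.
have psid s t : 0 <= s -> s <= t -> psi t <= psi s.
  apply: hder_le_prim => //; apply: ae_imply aeE => x h x0.
  have [l El la] := h x0; exists l => //; have := a0 x x0; lra.
have psim t : 0 <= t -> - I <= psi t.
  by move=> t0; have := QI t; have := E0 t t0; rewrite /psi; lra.
have cpsi : cvg (psi t @[t --> +oo]) := nonincreasing_cvg_pinfty psid psim.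
have cQI : cvg (- prim Q t @[t --> +oo]).
  apply: (@nonincreasing_cvg_pinfty _ _ (- I)) => [s t s0 st|t _].
    by rewrite lerN2; exact: prim_nondecreasing.
  by rewrite lerN2.
split.
- have -> : E = (fun t => psi t - - prim Q t) by apply/funext => t; rewrite /psi; ring.
  exact: (is_cvgB cpsi cQI).
- apply: (@integral_slope_lty psi a (- I)) => //.
    by apply: lacB => //; exact: prim_lac.
  have := ae_gt0 (fun t => @prim_hder R Q t cQ); move: aeE; apply: ae_imply2.
  move=> t h1 h2 t0; have [l El la] := h1 t0; exists (l - Q t).
    exact: hderB El (h2 t0).
  lra.
- exists (E 0 + I) => t t0; have := psid 0 t (lexx 0) t0; have := QI t.
  by rewrite /psi prim0; lra.
Qed.

(** Minus the primitive is nonincreasing and bounded below, with slope [- f t]. *)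
Lemma prim_bounded_integral_lty (f : R -> R) (M : R) : continuous f ->
  (forall t, 0 <= t -> 0 <= f t) -> (forall t, 0 <= t -> prim f t <= M) ->
  (\int[mu]_(t in `[0%R, +oo[) (f t)%:E < +oo)%E.
Proof.
move=> cf f0 fM.
apply: (@integral_slope_lty (fun t => 0 - prim f t) f (- M)) => //.
- by apply: lacB; [exact: lac_cst|exact: prim_lac].
- by move=> s t s0 st; rewrite lerD2l lerN2; exact: prim_nondecreasing.
- by move=> t t0; rewrite sub0r lerN2 fM.
apply: ae_gt0 => t t0; exists (0 - f t); last by rewrite sub0r opprK.
by apply: hderB; [exact: hder_cst|exact: prim_hder].
Qed.

End energy.

(** * Simple functions and the Bochner integral *)

Section simple_functions.
Context {R : realType} {V : normedModType R}.
Local Notation mu := (@lebesgue_measure R).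
Implicit Types (f s : R -> V) (v : V).

Lemma simple_fun0 : simple_fun (fun _ : R => 0 : V).
Proof.
split; first by apply: (sub_finite_set _ (finite_set1 (0 : V))) => _ [t _ <-].
move=> v; have [->|v0] := eqVneq v 0.
  by rewrite (_ : _ @^-1` _ = setT) //; apply/seteqP; split.
rewrite (_ : _ @^-1` _ = set0) //; apply/seteqP; split => // t /= /esym/eqP.
by rewrite (negPf v0).
Qed.

Lemma simple_fun_patch s v (c d : R) : simple_fun s ->
  simple_fun (fun t => if c <= t < d then v else s t).
Proof.
move=> [fs ms]; split.
  apply: (@sub_finite_set _ _ (range s `|` [set v])).
    by move=> _ [t _ <-]; case: ifP => _; [right|left; exists t].
  by rewrite finite_setU; split.
move=> w.
have mI : measurable (`[c, d[%classic : set R) by exact: measurable_itv.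
have itvE t : (c <= t < d) = (t \in `[c, d[) by rewrite in_itv.
have [->|wv] := eqVneq w v.
  rewrite (_ : _ @^-1` _ = `[c, d[%classic `|` s @^-1` [set v]).
    exact: measurableU.
  apply/seteqP; split=> t /=; rewrite itvE; case: ifP => h; [by left|by right|by []|].
  by case.
rewrite (_ : _ @^-1` _ = s @^-1` [set w] `\` `[c, d[%classic).
  exact: measurableD.
apply/seteqP; split=> t /=; rewrite itvE; case: ifP => h //.
- by move=> /esym/eqP; rewrite (negPf wv).
- by case=> _ nt; exfalso; exact: nt.
- by case.
Qed.

(** Real induction on the right end point: by continuity a constant value serves on a short
    half-open interval, which is patched onto the approximant already built. *)
Lemma simple_fun_approx f (T e : R) : continuous f -> 0 <= T -> 0 < e ->
  exists2 s, simple_fun s & forall t, 0 <= t < T -> `|f t - s t| <= e.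
Proof.
move=> cf T0 e0.
pose P c := exists2 s, simple_fun s & forall t, 0 <= t < c -> `|f t - s t| <= e.
have extend c d v s : simple_fun s -> (forall t, 0 <= t < c -> `|f t - s t| <= e) ->
    (forall t, c <= t < d -> `|f t - v| <= e) -> P d.
  move=> ss hs hv; exists (fun t => if c <= t < d then v else s t).
    exact: simple_fun_patch.
  move=> t /andP[t0 td]; rewrite td andbT; case: (leP c t) => ct.
    by apply: hv; rewrite ct.
  by apply: hs; rewrite t0.
have near_e c : exists2 d, 0 < d & forall t, `|c - t| < d -> `|f t - f c| <= e.
  have /cvgrPdist_le/(_ e e0)/(nbhs_ballP c)[d /= d0 h] := cf c.
  exists d => // t; rewrite distrC => td; rewrite distrC; apply: h.
  by rewrite -ball_normE /= distrC.
apply: (@real_induction R P 0 T) => [c /andP[c0 cT] hc|c _ [s ss hs]|]; last first.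
- by rewrite T0 lexx.
- have [d d0 hd] := near_e c; exists (c + d / 2) => [|x /andP[cx xd]]; first by lra.
  apply: (extend c x (f c) s) => // t /andP[ct tx]; apply: hd.
  rewrite distrC ger0_norm; lra.
- have [->|cn0] := eqVneq c 0.
    exists (fun=> 0); first exact: simple_fun0.
    by move=> t /andP[t0 /(le_lt_trans t0)]; rewrite ltxx.
  have [d d0 hd] := near_e c.
  have {cn0}c0 : 0 < c by rewrite lt_neqAle eq_sym cn0.
  pose b := Num.max 0 (c - d / 2).
  have b0 : 0 <= b by rewrite le_max lexx.
  have bc : b < c by rewrite gt_max c0; lra.
  have cd : c - d / 2 <= b by rewrite le_max lexx orbT.
  have [|s ss hs] := hc b; first by rewrite b0.
  apply: (extend b c (f c) s) => // t /andP[bt tc]; apply: hd.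
  rewrite gtr0_norm; lra.
Qed.

(** Diagonal choice: the simple function of index [n] is uniformly close to [w n] on a segment
    growing with [n]. This covers the acceleration, an almost everywhere limit of continuous
    difference quotients of the velocity. *)
Lemma strongly_measurable_lim (D : set R) f (w : nat -> R -> V) :
  (forall n, continuous (w n)) -> D `<=` `[0, +oo[ ->
  {ae mu, forall t, 0 <= t -> w n t @[n --> \oo] --> f t} ->
  strongly_measurable D f.
Proof.
move=> cw D0 aew.
have /choice[s hs] : forall n, exists s, simple_fun s /\
    forall t, 0 <= t < n%:R -> `|w n t - s t| <= n.+1%:R^-1.
  move=> n; have n0 : 0 < n.+1%:R^-1 :> R by rewrite invr_gt0.
  by have [s ss hs] := simple_fun_approx (cw n) (ler0n R n) n0; exists s.
exists s; split=> [n|]; first by have [] := hs n.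
apply: ae_imply aew => t wf Dt.
have t0 : 0 <= t by have := D0 _ Dt; rewrite /= in_itv /= andbT.
have sw : s n t - w n t @[n --> \oo] --> (0 : V).
  apply/cvgr0Pnorm_le => e e0; near=> n.
  rewrite distrC; apply: (@le_trans _ _ n.+1%:R^-1).
    apply: (hs n).2; rewrite t0 /=; near: n; exact: nbhs_infty_gtr.
  by apply: ltW; near: n; exact: near_harmonic_lt.
have : (s n t - w n t) + w n t @[n --> \oo] --> 0 + f t by apply: cvgD => //; exact: wf.
by under eq_fun do rewrite subrK; rewrite add0r.
Unshelve. all: by end_near. Qed.

End simple_functions.

Lemma near_lte {R : realType} {T : Type} (F : set_system T) (f : T -> \bar R)
    (l c : \bar R) : f @ F --> l -> (l < c)%E -> \forall t \near F, (f t < c)%E.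
Proof.
move=> fl lc; apply: (fl [set y | (y < c)%E]).
by apply: open_nbhs_nbhs; split => //; exact: open_ereal_lt_ereal.
Qed.

Section bochner.
Context {R : realType} {H : completeNormedModType R}.
Variables (ip : {dot H for idfun}) (ip_norm : induces_norm ip).
Local Notation mu := (@lebesgue_measure R).
Implicit Types (f s : R -> H).

(** Pairing with [y] reduces vector integrals to scalar ones: over the finite range of [s], the
    paired function is a sum of indicators of level sets with weights [ip v y]. *)
Lemma simple_integral_ip s (T : R) (y : H) : simple_fun s ->
  mu.-integrable `[0, T] (fun t => (ip (s t) y)%:E) /\
  ip (simple_integral `[0, T] s) y = \int[mu]_(t in `[0, T]) ip (s t) y.
Proof.
move=> [fs ms].
have [r0 r0E] := (finite_seqP _).1 fs.
pose r := undup r0.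
have rE : range s = [set` r] by rewrite r0E; apply/seteqP; split => v /=; rewrite mem_undup.
pose g v t := (ip v y * \1_(s @^-1` [set v]) t : R)%:E.
have mI : measurable (`[0, T]%classic : set R) by exact: measurable_itv.
have mu_itv : (mu `[0%R, T] < +oo)%E.
  by rewrite lebesgue_measure_itv /=; case: ifP => // _; rewrite -EFinB ltry.
have ig1 v : mu.-integrable `[0, T] (fun t => (\1_(s @^-1` [set v]) t : R)%:E).
  apply: measurable_bounded_integrable => //.
    exact: measurable_indic (ms v).
  exists 1; split => // M M1 t _ /=.
  by rewrite indicE; case: (_ \in _); rewrite ?normr1 ?normr0 ltW // (lt_trans _ M1).
have ig v : mu.-integrable `[0, T] (g v).
  by apply: (integrableZl _ (ip v y) (ig1 v)).
have sE t : (ip (s t) y)%:E = (\sum_(v <- r) g v t)%E.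
  rewrite sumEFin (bigD1_seq (s t)) /= ?undup_uniq //; last first.
    have : range s (s t) by exists t.
    by rewrite rE.
  rewrite big1_seq => [|v /andP[vs _]].
    by rewrite addr0 indicE mem_set // mulr1.
  rewrite indicE memNset ?mulr0 //= => sv.
  by rewrite sv eqxx in vs.
have -> : (fun t => (ip (s t) y)%:E) = (fun t => \sum_(v <- r) g v t)%E.
  by apply/funext.
split; first by apply: integrable_sum => [|v _]; [exact: measurable_itv|exact: ig].
rewrite /Rintegral.
under eq_integral do rewrite sE.
rewrite integral_sum //.
have muE v : (\int[mu]_(t in `[0%R, T]) g v t)%E =
    (ip v y * fine (mu (`[0, T] `&` s @^-1` [set v])))%:E.
  rewrite /g; under eq_integral do rewrite EFinM.
  rewrite integralZl // integral_indic //; last exact: ms.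
  rewrite setIC EFinM fineK // ge0_fin_numE //.
  apply: le_lt_trans mu_itv; apply: le_measure; rewrite ?inE //.
  by apply: measurableI => //; exact: ms.
under eq_bigr do rewrite muE.
rewrite sumEFin /= /simple_integral.
rewrite -(@fsbig_widen _ _ _ _ (range s) [set: H]) //; last first.
  move=> v [_ nv] /=; rewrite (_ : _ `&` _ = set0) ?measure0 ?scale0r //.
  by apply/seteqP; split => // t [_ st]; apply: nv; exists t.
rewrite rE -fsbig_seq ?undup_uniq //.
have lin (F : H -> H) (q : seq H) : ip (\sum_(v <- q) F v) y = \sum_(v <- q) ip (F v) y.
  elim: q => [|v q IH]; first by rewrite !big_nil linear0l.
  by rewrite !big_cons ipDl IH.
rewrite lin; apply: eq_bigr => v _.
by rewrite ipZl mulrC.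
Qed.

Lemma continuous_ip f (y : H) : continuous f -> continuous (fun t => ip (f t) y).
Proof. by move=> cf t; apply: cvg_ip => //; [exact: cf|exact: cvg_cst]. Qed.

(** Cauchy-Schwarz under the integral. The factor [|y| + 1], positive even for [y = 0], divides the
    left side so that the integral on the right is only compared, never rescaled, and its
    measurability does not matter. *)
Lemma simple_integral_dist f s (T : R) (y : H) : continuous f -> simple_fun s ->
  ((`|ip (simple_integral `[0, T] s) y - prim (fun t => ip (f t) y) T|
    / (`|y| + 1))%:E <= \int[mu]_(t in `[0%R, T]) (`|f t - s t|)%:E)%E.
Proof.
move=> cf ss; have [is_ ->] := simple_integral_ip T y ss.
have cfy := @continuous_ip f y cf.
have if_ := continuous_integrable_itv 0 T cfy.
have y0 : 0 < `|y| + 1 by have := normr_ge0 y; lra.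
have id_ : mu.-integrable `[0, T] (EFin \o (fun t => ip (s t) y - ip (f t) y)).
  by apply: (integrableB _ is_ if_).
rewrite -RintegralB //.
have in_ := integrable_norm id_.
rewrite mulrC; apply: (@le_trans _ _
  (\int[mu]_(t in `[0%R, T]) ((`|y| + 1)^-1 * `|ip (s t) y - ip (f t) y|)%:E)%E).
  rewrite -[leRHS]fineK; last first.
    apply: integrable_fin_num => //.
    by apply: (integrableZl _ (`|y| + 1)^-1 in_).
  rewrite lee_fin -/(Rintegral _ _ _) RintegralZl // ler_wpM2l ?invr_ge0 ?(ltW y0) //.
  exact: le_normr_Rintegral.
apply: ae_ge0_le_integral_nonmeasurable => [t _|t _|].
- by rewrite lee_fin mulr_ge0 // invr_ge0 ltW.
- by rewrite lee_fin.
apply: ae_of_all => t _; rewrite lee_fin ler_pdivrMl // -ipBl distrC.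
apply: (le_trans (ip_normM ip_norm _ _)).
by rewrite mulrC ler_wpM2r //; lra.
Qed.

Lemma is_bochner_integral_ip f (T : R) (v y : H) : continuous f ->
  is_bochner_integral `[0, T] f v -> ip v y = prim (fun t => ip (f t) y) T.
Proof.
move=> cf [_ [s [ss s0 sv]]].
have y0 : 0 < `|y| + 1 by have := normr_ge0 y; lra.
have svy : ip (simple_integral `[0, T] (s n)) y @[n --> \oo] --> ip v y.
  by apply: cvg_ip => //; exact: cvg_cst.
suff : ip (simple_integral `[0, T] (s n)) y @[n --> \oo]
    --> prim (fun t => ip (f t) y) T.
  exact: (cvg_unique _ svy).
apply/cvgrPdist_lt => e e0.
have e'0 : 0 < e / (`|y| + 1) by rewrite divr_gt0.
have s0' : \forall n \near \oo,
    (\int[mu]_(t in `[0%R, T]) (`|f t - s n t|)%:E < (e / (`|y| + 1))%:E)%E.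
  have : (0%:E < (e / (`|y| + 1))%:E)%E by rewrite lte_fin.
  exact: (near_lte s0).
apply: filterS s0' => n h; rewrite distrC.
have := le_lt_trans (simple_integral_dist T y cf (ss n).1) h.
by rewrite lte_fin ltr_pM2r // invr_gt0.
Qed.

(** The candidate is the weak integral, the vector that [riesz] attaches to the functional sending
    [y] to the primitive of [ip (f t) y]; the integrals of uniform simple approximants are then
    shown to converge to it in norm. *)
Lemma ex_bochner_integral f (T : R) : continuous f -> 0 <= T ->
  exists v, is_bochner_integral `[0, T] f v.
Proof.
move=> cf T0.
have [M M0 hM] := continuous_bounded_itv 0 T cf.
have cip y := @continuous_ip f y cf.
have [v hv] : exists v, forall y, ip v y = prim (fun t => ip (f t) y) T.
  apply: (@riesz _ _ ip ip_norm _ (M * T)).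
  - move=> x y; rewrite -primD //; congr (prim _ T); apply/funext => t.
    by rewrite ipDr.
  - move=> a x; rewrite -primZ //; congr (prim _ T); apply/funext => t.
    by rewrite ipZr.
  - move=> x; rewrite -[X in `|X|]subr0 -[X in _ - X](prim0 (fun t => ip (f t) x)).
    rewrite mulrAC -[X in _ * X](subr0 T).
    apply: prim_dist => // t tT; apply: (le_trans (ip_normM ip_norm _ _)).
    by rewrite ler_wpM2r //; exact: hM.
have T10 : 0 <= T + 1 by lra.
have /choice[s hs] : forall n : nat, exists s, simple_fun s /\
    forall t, 0 <= t < T + 1 -> `|f t - s t| <= n.+1%:R^-1.
  move=> n; have n0 : 0 < n.+1%:R^-1 :> R by rewrite invr_gt0.
  by have [s ss hs] := simple_fun_approx cf T10 n0; exists s.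
have muT : mu `[0, T] = T%:E.
  rewrite lebesgue_measure_itv /= lte_fin.
  case: ltP => [_|T0']; first by rewrite oppr0 adde0.
  by have -> : T = 0 by lra.
have mu_itv : (mu `[0%R, T] < +oo)%E by rewrite muT ltry.
have bs n : (\int[mu]_(t in `[0%R, T]) (`|f t - s n t|)%:E <= (n.+1%:R^-1 * T)%:E)%E.
  apply: (@le_trans _ _ (\int[mu]_(t in `[0%R, T]) cst (n.+1%:R^-1%:E) t)%E).
    apply: ae_ge0_le_integral_nonmeasurable => [t _|t _|].
    - by rewrite lee_fin.
    - by rewrite /= lee_fin invr_ge0.
    apply: ae_of_all => t; rewrite /= in_itv /= => /andP[t0 tT].
    by rewrite /= lee_fin; apply: (hs n).2; rewrite t0; lra.
  by rewrite integral_cst // EFinM; move: muT => /= ->.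
have hT : (n.+1%:R^-1 * T)%:E @[n --> \oo] --> 0%:E.
  apply: cvg_EFin; first exact: nearW.
  rewrite -[X in _ --> X](mul0r T); apply: cvgMl; exact: cvg_harmonic.
exists v; split.
  apply: (@strongly_measurable_lim _ _ _ f (fun=> f)) => //.
    by apply: subset_itvl; rewrite bnd_simp.
  by apply: ae_of_all => t _; exact: cvg_cst.
exists s; split.
- move=> n; split; first exact: (hs n).1.
  move=> w _; apply: le_lt_trans mu_itv; apply: le_measure; rewrite ?inE //.
  by apply: measurableI => //; exact: (hs n).1.2.
- apply: (@squeeze_cvge _ _ _ _ (cst 0%:E) _ (fun n => (n.+1%:R^-1 * T)%:E)) => //.
    apply: nearW => n; rewrite bs andbT; apply: integral_ge0 => t _.
    by rewrite lee_fin.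
  exact: cvg_cst.
(* The scalar estimate is tested with [y] equal to the error vector itself, which turns it into a
   bound on the norm. *)
- have dv n : `|v - simple_integral `[0, T] (s n)| ^+ 2 <=
      n.+1%:R^-1 * T * (`|v - simple_integral `[0, T] (s n)| + 1).
    set w := v - _.
    have := le_trans (simple_integral_dist T w cf (hs n).1) (bs n).
    rewrite lee_fin -hv distrC -ipBl -/w.
    rewrite ler_pdivrMr; last by have := normr_ge0 w; lra.
    by apply: le_trans; rewrite (ip_sqr ip_norm) ler_norm.
  apply/cvgrPdist_lt => e e0.
  (* Since r^2 / (r + 1) increases for r >= 0, a value below e^2 / (e + 1) forces r < e; the
     factorisation below is this monotonicity with cleared denominators. *)
  pose e' := e ^+ 2 / (e + 1).
  have e'0 : 0 < e' by rewrite divr_gt0 // ?exprn_gt0 //; lra.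
  near=> n.
  have : n.+1%:R^-1 * T < e'.
    rewrite -lte_fin; near: n; by apply: (near_lte hT); rewrite lte_fin.
  have := dv n; set w := `|_|; set q := _ * T => h1 h2.
  rewrite ltNge; apply/negP => ew.
  have q0 : 0 <= q by rewrite mulr_ge0 // invr_ge0.
  have h3 : q * (e + 1) < e ^+ 2 by rewrite -ltr_pdivlMr //; lra.
  have w10 : 0 < w + 1 by have := normr_ge0 (v - simple_integral `[0, T] (s n)); rewrite -/w; lra.
  have e10 : 0 < e + 1 by lra.
  have h4 : w ^+ 2 * (e + 1) < e ^+ 2 * (w + 1).
    apply: (@le_lt_trans _ _ (q * (w + 1) * (e + 1))); first by rewrite ler_pM2r.
    by rewrite mulrAC ltr_pM2r.
  have : 0 <= (w - e) * (w * e + w + e).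
    by rewrite mulr_ge0 ?subr_ge0 // !addr_ge0 ?mulr_ge0 //; lra.
  have -> : (w - e) * (w * e + w + e) = w ^+ 2 * (e + 1) - e ^+ 2 * (w + 1) by ring.
  lra.
Unshelve. all: by end_near. Qed.

Lemma bochner_integral_ip f (T : R) (y : H) : continuous f -> 0 <= T ->
  ip (bochner_integral `[0, T] f) y = prim (fun t => ip (f t) y) T.
Proof.
move=> cf T0; apply: is_bochner_integral_ip => //.
rewrite /bochner_integral; case: xgetP => [v -> //|nov].
by have [v /nov] := ex_bochner_integral cf T0.
Qed.

End bochner.

(** * Continuity, bounded primitives and operators *)

Section continuity_closure.
Context {R : realType}.
Implicit Types (f g : R -> R).

Lemma ctsC {V : normedModType R} (c : V) : continuous (fun _ : R => c).
Proof. by move=> t; exact: cvg_cst. Qed.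

Lemma ctsD {V : normedModType R} (f g : R -> V) :
  continuous f -> continuous g -> continuous (fun t => f t + g t).
Proof. by move=> cf cg t; apply: cvgD; [exact: cf|exact: cg]. Qed.

Lemma ctsB {V : normedModType R} (f g : R -> V) :
  continuous f -> continuous g -> continuous (fun t => f t - g t).
Proof. by move=> cf cg t; apply: cvgB; [exact: cf|exact: cg]. Qed.

Lemma ctsZ {V : normedModType R} f (g : R -> V) :
  continuous f -> continuous g -> continuous (fun t => f t *: g t).
Proof. by move=> cf cg t; apply: cvgZ; [exact: cf|exact: cg]. Qed.

Lemma ctsM f g : continuous f -> continuous g -> continuous (fun t => f t * g t).
Proof. by move=> cf cg t; apply: cvgM; [exact: cf|exact: cg]. Qed.

Lemma ctsX2 f : continuous f -> continuous (fun t => f t ^+ 2).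
Proof. by move=> cf; under eq_fun do rewrite expr2; exact: ctsM. Qed.

Lemma ctsN {V : normedModType R} (f : R -> V) :
  continuous f -> continuous (fun t => `|f t|).
Proof. by move=> cf t; apply: cvg_norm; exact: cf. Qed.

Lemma cts_max f g : continuous f -> continuous g ->
  continuous (fun t => Num.max (f t) (g t)).
Proof.
move=> cf cg.
have -> : (fun t => Num.max (f t) (g t)) =
    (fun t => 2^-1 * (f t + g t + `|f t - g t|)).
  apply/funext => t; case: (leP (f t) (g t)) => h.
    by rewrite ler0_norm; lra.
  by rewrite gtr0_norm; lra.
by apply: ctsM; [exact: ctsC|apply: ctsD; [exact: ctsD|apply: ctsN; exact: ctsB]].
Qed.

Lemma cts_ip {H : completeNormedModType R} (ip : {dot H for idfun})
    (ip_norm : induces_norm ip) (f g : R -> H) :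
  continuous f -> continuous g -> continuous (fun t => ip (f t) (g t)).
Proof. by move=> cf cg t; apply: cvg_ip => //; [exact: cf|exact: cg]. Qed.

End continuity_closure.

Ltac cts_step := lazymatch goal with
  | |- forall t, continuous_at t ?f =>
    lazymatch f with
    | fun s => Num.max (@?g s) (@?h s) => apply: (@cts_max _ g h)
    | fun s => @?g s - @?h s => apply: (@ctsB _ _ g h)
    | fun s => @?g s + @?h s => apply: (@ctsD _ _ g h)
    | fun s => @?g s * @?h s => apply: (@ctsM _ g h)
    | fun s => @?g s *: @?h s => apply: (@ctsZ _ _ g h)
    | fun s => @?g s ^+ 2 => apply: (@ctsX2 _ g)
    | fun s => `|@?g s| => apply: (@ctsN _ _ g)
    | _ => first [assumption | exact: ctsC | apply: cts_ip; [assumption| |]]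
    end
  end.

Ltac cts := repeat cts_step.

Section bounded_primitives.
Context {R : realType}.
Implicit Types (f g : R -> R).

(** For nonnegative continuous [f] this is integrability; for signed [f] it is deliberately
    one-sided, which suffices to bound averages from above. *)
Definition prim_bounded f : Prop := exists M, forall t, 0 <= t -> prim f t <= M.

Lemma prim_boundedD f g : continuous f -> continuous g ->
  prim_bounded f -> prim_bounded g -> prim_bounded (fun t => f t + g t).
Proof.
move=> cf cg [M hM] [N hN]; exists (M + N) => t t0.
by rewrite primD // lerD // ?hM ?hN.
Qed.

Lemma prim_boundedZ f k : continuous f -> 0 <= k ->
  prim_bounded f -> prim_bounded (fun t => k * f t).
Proof.
move=> cf k0 [M hM]; exists (k * M) => t t0.
by rewrite primZ // ler_wpM2l // hM.
Qed.

Lemma prim_bounded_le f g : continuous f -> continuous g ->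
  (forall t, 0 <= t -> f t <= g t) -> prim_bounded g -> prim_bounded f.
Proof.
move=> cf cg fg [M hM]; exists M => t t0; apply: le_trans (hM t t0).
by apply: le_prim => // s /andP[s0 _]; exact: fg.
Qed.

(** On the compact initial segment [f] is bounded, and afterwards the primitive no longer grows.
    Asymptotic hypotheses on the parameters enter through this lemma. *)
Lemma prim_bounded_npos f (T : R) : continuous f ->
  (forall t, T <= t -> f t <= 0) -> prim_bounded f.
Proof.
move=> cf fT; pose T' := Num.max 0 T.
have T0 : 0 <= T' by rewrite le_max lexx.
have TT : T <= T' by rewrite le_max lexx orbT.
have [M M0 hM] := continuous_bounded_itv 0 T' (cf : continuous (f : R -> R^o)).
have fM s t : 0 <= s -> s <= t -> t <= T' -> prim f t - prim f s <= M * (t - s).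
  move=> s0 st tT; apply: prim_incr_le => // x /andP[sx xt].
  apply: le_trans (ler_norm _) _; apply: hM.
  by rewrite (le_trans s0) // (le_trans xt).
exists (M * T') => t t0; have [tT|tT] := leP t T'.
  have := fM 0 t (lexx 0) t0 tT; rewrite prim0 !subr0 => /le_trans; apply.
  by rewrite ler_wpM2l.
have := fM 0 T' (lexx 0) T0 (lexx T'); rewrite prim0 !subr0 => h.
have : prim f t - prim f T' <= 0 * (t - T').
  by apply: prim_incr_le => // [|x /andP[Tx _]]; [exact: ltW|apply: fT; exact: le_trans Tx].
lra.
Qed.

Lemma prim_bounded_lty f : continuous f -> (forall t, 0 <= t -> 0 <= f t) ->
  prim_bounded f ->
  (\int[lebesgue_measure]_(t in `[0%R, +oo[) (f t)%:E < +oo)%E.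
Proof. by move=> cf f0 [M hM]; exact: prim_bounded_integral_lty hM. Qed.

Lemma lty_prim_bounded f : continuous f -> (forall t, 0 <= t -> 0 <= f t) ->
  (\int[lebesgue_measure]_(t in `[0%R, +oo[) (f t)%:E < +oo)%E ->
  prim_bounded f.
Proof.
move=> cf f0 foo; exists (fine (\int[lebesgue_measure]_(t in `[0%R, +oo[) (f t)%:E)%E) => t t0.
rewrite -lee_fin; apply: (le_trans (prim_le_integral t f0 cf)).
rewrite fineK // ge0_fin_numE //; apply: integral_ge0 => s /=.
by rewrite in_itv /= andbT lee_fin; exact: f0.
Qed.

(** If [l] were positive, [f] would eventually exceed [l / 2], and the weighted primitive would
    dominate [l / 2] times that of [w] up to a constant. Used with weight 1 for the velocity and
    weight [lambda] for strong convergence. *)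
Lemma weighted_cvg_le0 (w f : R -> R) (l : R) : continuous w -> continuous f ->
  (forall t, 0 <= t -> 0 <= w t) -> (forall M, exists2 t, 0 <= t & M < prim w t) ->
  (forall t, 0 <= t -> 0 <= f t) ->
  prim_bounded (fun t => w t * f t) -> f t @[t --> +oo] --> l -> l <= 0.
Proof.
move=> cw cf w0 winf f0 [M hM] fl; rewrite leNgt; apply/negP => l0.
have l20 : 0 < l / 2 by rewrite divr_gt0.
have [T [_ hT]] : \forall t \near +oo, l / 2 < f t.
  have /cvgrPdist_lt/(_ _ l20) h := fl.
  have aux (y : R) : l - y < l / 2 -> l / 2 < y by lra.
  by apply: filterS h => t; rewrite ltr_norml => /andP[_ /aux].
have [K hK] : prim_bounded (fun t => w t * (l / 2 - f t)).
  apply: (@prim_bounded_npos _ (Num.max 0 (T + 1))); first by cts. 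
  move=> t; rewrite ge_max => /andP[t0 Tt]; rewrite mulr_ge0_le0 ?w0 // subr_le0 ltW //.
  by apply: hT; lra.
have [t t0 ht] := winf ((K + M) / (l / 2)).
have := hK t t0; have := hM t t0.
have -> : (fun t => w t * (l / 2 - f t)) = (fun t => l / 2 * w t - w t * f t).
  by apply/funext => s; ring.
rewrite primB ?primZ //; [|by cts|by cts].
rewrite ltr_pdivrMr // in ht; lra.
Qed.

End bounded_primitives.

Section operators.
Context {R : realType} {H : completeNormedModType R}.
Variables (ip : {dot H for idfun}) (ip_norm : induces_norm ip).

Lemma cocoercive_lipschitz (F : H -> H) (L : R) : 0 < L ->
  cocoercive ip L^-1 F -> forall x y, `|F x - F y| <= L * `|x - y|.
Proof.
move=> L0 [_ hF] x y.
have := le_trans (hF x y) (ip_le ip_norm _ _).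
have [->|n0] := eqVneq (`|F x - F y|) 0; first by move=> _; rewrite mulr_ge0 // ltW.
have {}n0 : 0 < `|F x - F y| by rewrite lt0r n0 normr_ge0.
by rewrite expr2 mulrA ler_pM2r // ler_pdivrMl.
Qed.

Lemma cocoercive_continuous (F : H -> H) (L : R) (x : R -> H) : 0 < L ->
  cocoercive ip L^-1 F -> continuous x -> continuous (fun t => F (x t)).
Proof.
move=> L0 cF cx t; apply/cvgrPdist_lt => e e0.
have e'0 : 0 < e / L by rewrite divr_gt0.
have /cvgrPdist_lt/(_ _ e'0) := cx t; apply: filterS => s hs.
apply: le_lt_trans (cocoercive_lipschitz L0 cF _ _) _.
by rewrite mulrC -ltr_pdivlMr.
Qed.

(* Young's inequality absorbs the cross terms <q, Dx + m> and <q, Bx> into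
   9/20 |q|^2. *)
Lemma monotone_step (x q z u m p Dx Bx : H) (l b eta : R) : 0 < l ->
  eta * `|q + x - u| ^+ 2 <= ip (z - m) (q + x - u) ->
  x - l *: Dx - (l * b) *: Bx = q + x + l *: z ->
  ip (x - u) q + 11 / 20 * `|q| ^+ 2 + eta * l * `|q + x - u| ^+ 2
    + l * ip (x - u) (Dx + m + p) + 1 / 16 * (l * b) * ip (x - u) Bx <=
  5 * l ^+ 2 * `|Dx + m| ^+ 2
    + Num.max 0 (l * ip (x - u) p - 1 / 4 * (l * b) * ip (x - u) Bx)
    + Num.max 0 (5 / 8 * (l * b) ^+ 2 * `|Bx| ^+ 2 - 11 / 16 * (l * b) * ip (x - u) Bx).
Proof.
move=> l0 mono ode.
have lz : l *: z = - q - l *: Dx - (l * b) *: Bx.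
  by rewrite -[LHS](addKr (q + x)) -ode opprD !addrA subrK.
have h1 : l * (eta * `|q + x - u| ^+ 2) <=
    ip (- q - l *: Dx - (l * b) *: Bx - l *: m) (q + (x - u)).
  by rewrite -lz -scalerBr ipZl ler_pM2l // addrA.
have h2 : 0 <= `|q| ^+ 2 + 20 * (l * ip q (Dx + m)) + 100 * l ^+ 2 * `|Dx + m| ^+ 2.
  have := sqr_ge0 `|q + (10 * l) *: (Dx + m)|.
  rewrite (norm_sqrD ip_norm q) ipZr normrZ exprMn real_normK ?num_real //; lra.
have h3 : 0 <= `|q| ^+ 2 + 5 / 2 * (l * b * ip q Bx) + 25 / 16 * (l * b) ^+ 2 * `|Bx| ^+ 2.
  have := sqr_ge0 `|q + (5 / 4 * (l * b)) *: Bx|.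
  rewrite (norm_sqrD ip_norm q) ipZr normrZ exprMn real_normK ?num_real //; lra.
(* The unit weight of [(l * b) * ip (x - u) Bx] is split as 1/16 + 1/4 + 11/16: the first share is
   kept as dissipation, the second pays for [p], and the third absorbs the Young term with its
   smaller coefficient 5/8. *)
have g1 : l * ip (x - u) p - 1 / 4 * (l * b) * ip (x - u) Bx <=
    Num.max 0 (l * ip (x - u) p - 1 / 4 * (l * b) * ip (x - u) Bx).
  by rewrite le_max lexx orbT.
have g2 : 5 / 8 * (l * b) ^+ 2 * `|Bx| ^+ 2 - 11 / 16 * (l * b) * ip (x - u) Bx <=
    Num.max 0 (5 / 8 * (l * b) ^+ 2 * `|Bx| ^+ 2 - 11 / 16 * (l * b) * ip (x - u) Bx).
  by rewrite le_max lexx orbT.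
move: h1 h2 h3 g1 g2; set G1 := Num.max _ _; set G2 := Num.max _ _.
set y := x - u; clearbody y; set W := Dx + m => h1 h2 h3 g1 g2.
have hE : ip (- q - l *: Dx - (l * b) *: Bx - l *: m) (q + y) =
    - `|q| ^+ 2 - ip y q - l * ip q W - l * ip y W - l * b * ip q Bx - l * b * ip y Bx.
  rewrite -(ip_sqr ip_norm) /W !ipE [ip Dx q]ipC [ip Bx q]ipC [ip m q]ipC [ip q y]ipC.
  by rewrite [ip Dx y]ipC [ip Bx y]ipC [ip m y]ipC; ring.
rewrite hE in h1; rewrite ipDr; lra.
Qed.

End operators.

(** * Weak convergence *)

Lemma fmap_ultra {S T : Type} (g : S -> T) (U : set_system S) :
  UltraFilter U -> UltraFilter (g t @[t --> U]).
Proof.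
move=> UU; split; first by apply: fmap_proper_filter; exact: ultra_proper.
move=> G PG UG; apply/seteqP; split=> [A GA|]; last exact: UG.
have [//|UnA] := in_ultra_setVsetC (g @^-1` A) UU.
have [x [Ax nAx]] := filter_ex (filterI GA (UG (~` A) UnA)).
by [].
Qed.

Section weak_convergence.
Context {R : realType} {H : completeNormedModType R}.
Variables (ip : {dot H for idfun}) (ip_norm : induces_norm ip).
Context {T : topologicalType} (f : T -> H) (M : R).

Definition weak_limit (F : set_system T) (z : H) : Prop :=
  forall y, ip (f t) y @[t --> F] --> ip z y.

(** Weak compactness of balls: along an ultrafilter each bounded scalar [ip (f t) y] converges, the
    limit is linear and bounded in [y], and [riesz] represents it. *)
Lemma ultra_weak_limit (U : set_system T) : UltraFilter U ->
  U [set t | `|f t| <= M] -> exists z, weak_limit U z.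
Proof.
move=> UU UM; have PU : ProperFilter U by exact: (@ultra_proper _ _ UU).
have UB y : \forall t \near U, `|ip (f t) y| <= M * `|y|.
  apply: filterS UM => t /= tM; apply: (le_trans (ip_normM ip_norm _ _)).
  by rewrite ler_wpM2r.
have /choice[l hl] : forall y, exists l : R, ip (f t) y @[t --> U] --> l.
  move=> y; have := @segment_compact R (- (M * `|y|)) (M * `|y|).
  rewrite compact_ultra => /(_ (ip (f t) y @[t --> U])).
  have UF : UltraFilter (ip (f t) y @[t --> U]).
    exact: fmap_ultra.
  case=> //; last by move=> l [_ hl]; exists l.
  by apply: filterS (UB y) => t /=; rewrite in_itv /= -ler_norml.
have lU y c : ip (f t) y @[t --> U] --> c -> l y = c.
  exact: (cvg_unique (@norm_hausdorff _ R) (hl y)).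
suff [z hz] : exists z, forall y, ip z y = l y by exists z => y; rewrite hz.
apply: (@riesz _ _ ip ip_norm l M).
- move=> y z; apply: lU; under eq_fun do rewrite ipDr.
  by apply: cvgD; exact: hl.
- move=> a y; apply: lU; under eq_fun do rewrite ipZr.
  by apply: cvgMr; exact: hl.
- move=> y; have h1 : `|ip (f t) y| @[t --> U] --> `|l y| by apply: cvg_norm; exact: hl.
  exact: (ler_cvg_to h1 (cvg_cst (M * `|y|)) (UB y)).
Qed.

(** If convergence failed against some [y], the bad times would meet every set of [F]; an
    ultrafilter refining [F] on them would have a weak limit distinct from [z0], against
    uniqueness. *)
Lemma weak_limit_from_ultra (F : set_system T) (P : H -> Prop) : ProperFilter F ->
  F [set t | `|f t| <= M] ->
  (forall U z, UltraFilter U -> F `<=` U -> weak_limit U z -> P z) ->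
  (forall U1 U2 z1 z2, UltraFilter U1 -> UltraFilter U2 -> F `<=` U1 -> F `<=` U2 ->
    weak_limit U1 z1 -> weak_limit U2 z2 -> z1 = z2) ->
  exists2 z, P z & weak_limit F z.
Proof.
move=> PF FM hP huniq.
have [U0 [UU0 FU0]] := ultraFilterLemma PF.
have [z0 hz0] := ultra_weak_limit UU0 (FU0 _ FM).
exists z0; first exact: hP hz0.
move=> y; apply/cvgrPdist_lt => e e0; apply: contrapT => nF.
pose S := [set t | e <= `|ip z0 y - ip (f t) y|].
have PS : ProperFilter (within S F).
  split; last exact: within_filter.
  move=> h; apply: nF; move: h; rewrite /within /=; apply: filterS => t /= hS; rewrite ltNge; apply/negP.
  by move/hS.
have [U [UU SU]] := ultraFilterLemma PS.
have FU : F `<=` U by move=> Q FQ; apply: SU; rewrite /within /=; apply: filterS FQ => t Qt _.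
have [z hz] := ultra_weak_limit UU (FU _ FM).
have zE := huniq _ _ _ _ UU UU0 FU FU0 hz hz0.
have PU : ProperFilter U by exact: (@ultra_proper _ _ UU).
have US : U S by apply: SU; rewrite /within /=; apply: filterE.
have := hz y; rewrite zE => /cvgrPdist_lt/(_ e e0) Ue.
have [t [St]] := filter_ex (filterI US Ue).
by rewrite ltNge St.
Qed.

End weak_convergence.

(** * The trajectory *)

Section trajectory.
Context {R : realType} {H : completeNormedModType R}.
Variables (ip : {dot H for idfun}) (ip_norm : induces_norm ip).
Variables (A : H -> set H) (D B : H -> H) (L_D L_B : R).
Variables (gamma lambda beta : R -> R) (x v a : R -> H).
Local Notation mu := (@lebesgue_measure R).
Local Notation C := (zer (single B)).
Local Notation Z := (zer (op_add (op_add A (single D)) (normal_cone ip C))).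
Hypotheses (L_D0 : 0 < L_D) (L_B0 : 0 < L_B).
Hypotheses (D_coco : cocoercive ip L_D^-1 D) (B_coco : cocoercive ip L_B^-1 B).
Hypotheses (cl : continuous lambda) (cb : continuous beta).
Hypotheses (cx : continuous x) (cv : continuous v).
Hypotheses (lam0 : forall t, 0 <= t -> 0 < lambda t).
Hypotheses (bet0 : forall t, 0 <= t -> 0 < beta t).
Hypotheses (lacx : locally_abs_continuous x) (lacv : locally_abs_continuous v).
Hypothesis lacg : locally_abs_continuous (gamma : R -> R^o).
Hypothesis xv : forall t, 0 <= t -> hder x t (v t).
Hypothesis ode : {ae mu, forall t, 0 <= t -> hder v t (a t) /\
  exists2 z, A (a t + gamma t *: v t + x t) z &
    x t - lambda t *: D (x t) - (lambda t * beta t) *: B (x t) =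
    a t + gamma t *: v t + x t + lambda t *: z}.
Hypothesis gam : {ae mu, forall t, 0 <= t -> Num.sqrt 2 <= gamma t /\
  exists2 l : R^o, hder (gamma : R -> R^o) t l & l <= 0}.

(** * Bounds on the damping coefficient *)

Lemma gamma_nonincreasing s t : 0 <= s -> s <= t -> gamma t <= gamma s.
Proof.
apply: (hder_nonincreasing lacg); apply: ae_imply gam => r h r0.
by have [] := h r0.
Qed.

(** Being nonincreasing, [gamma] would stay below the bound on an interval of positive measure once
    it fell below it. *)
Lemma gamma_ge_sqrt2 t : 0 <= t -> Num.sqrt 2 <= gamma t.
Proof.
move=> t0; rewrite leNgt; apply/negP => gt.
have [N [mN muN0 subN]] := gam.
have sub : `]t, (t + 1)[ `<=` N.
  move=> s /=; rewrite in_itv /= => /andP[ts _]; apply: subN => /= h.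
  have s0 : 0 <= s by rewrite (le_trans t0) // ltW.
  have [h1 _] := h s0.
  by have := le_lt_trans (gamma_nonincreasing t0 (ltW ts)) gt; rewrite ltNge h1.
have : (mu `]t, (t + 1)%R[%classic <= mu N)%E by apply: le_measure; rewrite ?inE.
rewrite muN0 lebesgue_measure_itv /= lte_fin ltrDl ltr01 -EFinB lee_fin.
by rewrite addrC addKr ler10.
Qed.

(** 7/5 is a rational number below the square root of 2, good enough for coercivity; the bound on
    the square is the one used in the dissipation. *)
Lemma gamma_bounds t : 0 <= t -> 7 / 5 <= gamma t /\ 2 <= gamma t ^+ 2.
Proof.
move=> /gamma_ge_sqrt2 h.
have s0 : 0 <= Num.sqrt 2 :> R by exact: sqrtr_ge0.
have s2 : Num.sqrt 2 ^+ 2 = 2 :> R by rewrite sqr_sqrtr.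
split; last by rewrite -s2 ler_pXn2r // nnegrE (le_trans s0).
apply: le_trans h; rewrite -(@ler_pXn2r _ 2) // ?nnegrE // s2; lra.
Qed.

(** * The Lyapunov function and its dissipation *)

Definition energy (u : H) (t : R) : R :=
  20 * ip (x t - u) (v t)
    + gamma t * (10 * ip (x t - u) (x t - u) + 11 * ip (v t) (v t)).

Lemma lac_shifted u : locally_abs_continuous (fun t => x t - u).
Proof. by apply: lacB => //; exact: lac_cst. Qed.

Lemma energy_lac u : locally_abs_continuous (energy u : R -> R^o).
Proof.
have acxu := lac_shifted u.
have lacMR (f g : R -> R) : locally_abs_continuous (f : R -> R^o) ->
    locally_abs_continuous (g : R -> R^o) ->
    locally_abs_continuous (fun t => f t * g t : R^o) by move=> *; exact: lacM.
apply: (@lacD R R^o).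
  by apply: (lacMR); [exact: (@lac_cst R R^o)|exact: lac_ip].
apply: (lacMR) => //; apply: (@lacD R R^o).
  by apply: (lacMR); [exact: (@lac_cst R R^o)|exact: lac_ip].
by apply: (lacMR); [exact: (@lac_cst R R^o)|exact: lac_ip].
Qed.

Lemma energy_hder u t (g : R^o) : 0 <= t ->
  hder (gamma : R -> R^o) t g -> hder v t (a t) ->
  hder (energy u : R -> R^o) t (20 * (`|v t| ^+ 2 + ip (x t - u) (a t))
    + (g * (10 * `|x t - u| ^+ 2 + 11 * `|v t| ^+ 2)
       + gamma t * (20 * ip (x t - u) (v t) + 22 * ip (v t) (a t)))).
Proof.
move=> t0 hg hv.
have hx := xv t0.
have hxu : hder (fun s => x s - u) t (v t).
  by have := hderB hx (hder_cst u t); rewrite subr0.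
have hM (k : R) f l : hder f t l -> hder (fun s => k * f s : R^o) t (k * l).
  by move=> hf; have := hderM (hder_cst (k : R^o) t) hf; rewrite mul0r add0r.
have h1 := hM 20 _ _ (hder_ip ip_norm hxu hv).
have h2 := hM 10 _ _ (hder_ip ip_norm hxu hxu).
have h3 := hM 11 _ _ (hder_ip ip_norm hv hv).
have := hderD h1 (hderM hg (hderD h2 h3)).
rewrite /energy !(ip_sqr ip_norm) [ip (v t) (x t - u)]ipC [ip (a t) (v t)]ipC.
by congr (hder _ _ _); ring.
Qed.

(** The cross term costs at most 10 of each square, while [gamma t >= 7 / 5] provides 14 and
    15.4. *)
Lemma energy_ge u t : 0 <= t ->
  4 * `|x t - u| ^+ 2 + 5 * `|v t| ^+ 2 <= energy u t.
Proof.
move=> /gamma_bounds[g7 _]; rewrite /energy !(ip_sqr ip_norm).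
have := sqr_ge0 `|(x t - u) + v t|; rewrite (norm_sqrD ip_norm (x t - u)) => h.
have := sqr_ge0 `|x t - u|; have := sqr_ge0 `|v t|.
move: h; set X := `|x t - u| ^+ 2; set V := `|v t| ^+ 2; set P := ip (x t - u) (v t).
move=> h V0 X0.
have : 7 / 5 * (10 * X + 11 * V) <= gamma t * (10 * X + 11 * V).
  by rewrite ler_wpM2r // addr_ge0 // mulr_ge0.
lra.
Qed.

(** For [p] normal to [C] at [u], four times this is at most [lambda t * beta t] times the
    Fitzpatrick gap at 4 p / beta, through the test points [x t] and [u] in the supremum defining
    the Fitzpatrick function. *)
Definition fitz_gap u p t : R := Num.max 0
  (lambda t * ip (x t - u) p - 1 / 4 * (lambda t * beta t) * ip (x t - u) (B (x t))).

(* Both excesses vanish for large t: the first once lambda beta <= 1 / L_B, the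
   second once lambda <= 1 / (20 L_D). *)
Definition B_excess u t : R := Num.max 0
  (5 / 8 * (lambda t * beta t) ^+ 2 * `|B (x t)| ^+ 2
   - 11 / 16 * (lambda t * beta t) * ip (x t - u) (B (x t))).

Definition D_excess u t : R := Num.max 0
  (200 * lambda t ^+ 2 * `|D (x t) - D u| ^+ 2
   - 10 * lambda t * ip (x t - u) (D (x t) - D u)).

(** [eta] is 0 for monotone [A] and positive for strongly monotone [A]. The coefficient 10 is half
    of the available 20, the other half going to [D_excess]; 5/4 is 20 times the share 1/16. *)
Definition dissipation (eta : R) u t : R :=
  11 * `|a t| ^+ 2 + 2 * `|v t| ^+ 2
    + 20 * eta * lambda t * `|a t + gamma t *: v t + x t - u| ^+ 2
    + 10 * lambda t * ip (x t - u) (D (x t) - D u)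
    + 5 / 4 * (lambda t * beta t) * ip (x t - u) (B (x t)).

(** Here [(u, m)] is a graph point and [p] is arbitrary because there are two uses: at zeros the
    pairing with [D (x t) + m + p] is nonnegative, whereas at general points of the graph of A + N_C
    it has no sign and becomes the quantity to be bounded. *)
Lemma energy_slope u m p eta : A u m -> 0 <= eta ->
  (forall y w, A y w -> eta * `|y - u| ^+ 2 <= ip (w - m) (y - u)) ->
  {ae mu, forall t, 0 <= t -> exists2 l : R^o, hder (energy u : R -> R^o) t l &
    hder v t (a t) /\
    l + 11 * `|a t| ^+ 2 + 2 * `|v t| ^+ 2
      + 20 * eta * lambda t * `|a t + gamma t *: v t + x t - u| ^+ 2
      + 20 * lambda t * ip (x t - u) (D (x t) + m + p)
      + 5 / 4 * (lambda t * beta t) * ip (x t - u) (B (x t)) <=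
    100 * lambda t ^+ 2 * `|D (x t) + m| ^+ 2
      + 20 * (fitz_gap u p t + B_excess u t)}.
Proof.
move=> Aum eta0 mono; move: ode gam; apply: ae_imply2 => t h1 h2 t0.
have [hv [z Az odet]] := h1 t0; have [_ [g hg g0]] := h2 t0.
eexists; first exact: energy_hder hg hv.
split=> //.
have step := monotone_step ip_norm p (lam0 t0) (mono _ _ Az) odet.
have [_ g2] := gamma_bounds t0.
have qE : `|a t + gamma t *: v t| ^+ 2 =
    `|a t| ^+ 2 + 2 * gamma t * ip (v t) (a t) + gamma t ^+ 2 * `|v t| ^+ 2.
  rewrite (norm_sqrD ip_norm) ipZr normrZ exprMn real_normK ?num_real // ipC; ring.
rewrite qE ipDr ipZr in step; move: step; rewrite -/(fitz_gap u p t) -/(B_excess u t).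
have V0 := sqr_ge0 `|v t|.
have h3 : g * (10 * `|x t - u| ^+ 2 + 11 * `|v t| ^+ 2) <= 0.
  by rewrite mulr_le0_ge0 // addr_ge0 // mulr_ge0 // sqr_ge0.
have h4 : 2 * `|v t| ^+ 2 <= gamma t ^+ 2 * `|v t| ^+ 2 by rewrite ler_wpM2r.
lra.
Qed.

Lemma zerP u : Z u -> B u = 0 /\ exists2 m, A u m & normal_cone ip C u (- D u - m).
Proof.
move=> [w [n [[m [d [Aum -> ->]]] Nun /esym/eqP]]].
rewrite addr_eq0 => /eqP E; split; first by have [-> _] := Nun.
exists m => //; rewrite -opprD addrC E opprK.
exact: Nun.
Qed.

Lemma cDx : continuous (fun t => D (x t)).
Proof. exact: cocoercive_continuous D_coco cx. Qed.

Lemma cBx : continuous (fun t => B (x t)).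
Proof. exact: cocoercive_continuous B_coco cx. Qed.

Lemma cont_fitz_gap u p : continuous (fitz_gap u p).
Proof. by have := cBx => ?; rewrite /fitz_gap; cts. Qed.

Lemma cont_B_excess u : continuous (B_excess u).
Proof. by have := cBx => ?; rewrite /B_excess; cts. Qed.

Lemma cont_D_excess u : continuous (D_excess u).
Proof. by have := cDx => ?; rewrite /D_excess; cts. Qed.

Lemma ip_B_ge u t : B u = 0 -> L_B^-1 * `|B (x t)| ^+ 2 <= ip (x t - u) (B (x t)).
Proof. by move=> Bu; have := B_coco.2 (x t) u; rewrite Bu subr0. Qed.

Lemma ip_D_ge u t : L_D^-1 * `|D (x t) - D u| ^+ 2 <= ip (x t - u) (D (x t) - D u).
Proof. exact: D_coco.2. Qed.

Lemma ip_B_ge0 u t : B u = 0 -> 0 <= ip (x t - u) (B (x t)).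
Proof.
move=> Bu; apply: le_trans (ip_B_ge t Bu).
by rewrite mulr_ge0 ?sqr_ge0 // invr_ge0 ltW.
Qed.

Lemma ip_D_ge0 u t : 0 <= ip (x t - u) (D (x t) - D u).
Proof.
apply: le_trans (ip_D_ge u t).
by rewrite mulr_ge0 ?sqr_ge0 // invr_ge0 ltW.
Qed.

Hypothesis lam_sqr : prim_bounded (fun t => lambda t ^+ 2).
Hypothesis lam_inf : forall M, exists2 t, 0 <= t & M < prim lambda t.
Hypothesis lam_cvg0 : forall e, 0 < e -> exists T, forall t, T <= t -> lambda t <= e.
Hypothesis lam_bet : exists T, forall t, T <= t -> lambda t * beta t <= L_B^-1.
Hypothesis fitz : forall u p, normal_cone ip C u p -> prim_bounded (fitz_gap u p).

Lemma B_excess_bounded u : B u = 0 -> prim_bounded (B_excess u).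
Proof.
move=> Bu; have [T hT] := lam_bet.
apply: (@prim_bounded_npos _ _ (Num.max 0 T)); first exact: cont_B_excess.
move=> t; rewrite ge_max => /andP[t0 Tt]; rewrite /B_excess ge_max lexx /= subr_le0.
have lb0 : 0 <= lambda t * beta t by rewrite mulr_ge0 // ltW ?lam0 ?bet0.
have h1 : lambda t * beta t * `|B (x t)| ^+ 2 <= ip (x t - u) (B (x t)).
  by apply: le_trans (ip_B_ge t Bu); rewrite ler_wpM2r ?sqr_ge0 // hT.
have := ler_wpM2l lb0 h1; have := mulr_ge0 lb0 (ip_B_ge0 t Bu); lra.
Qed.

Lemma D_excess_bounded u : prim_bounded (D_excess u).
Proof.
have e0 : 0 < L_D^-1 / 20 by rewrite divr_gt0 // invr_gt0.
have [T hT] := lam_cvg0 e0.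
apply: (@prim_bounded_npos _ _ (Num.max 0 T)); first exact: cont_D_excess.
move=> t; rewrite ge_max => /andP[t0 Tt]; rewrite /D_excess ge_max lexx /= subr_le0.
have l0 : 0 <= lambda t by rewrite ltW ?lam0.
have h1 : lambda t * `|D (x t) - D u| ^+ 2 <= L_D^-1 / 20 * `|D (x t) - D u| ^+ 2.
  by rewrite ler_wpM2r ?sqr_ge0 // hT.
have := ler_wpM2l l0 (le_trans h1 _).
move=> /(_ (ip (x t - u) (D (x t) - D u) / 20)) h2.
have : lambda t * (lambda t * `|D (x t) - D u| ^+ 2) <=
    lambda t * (ip (x t - u) (D (x t) - D u) / 20).
  by apply: h2; have := ip_D_ge u t; lra.
lra.
Qed.

Lemma dissipation_integrable u m eta : B u = 0 -> A u m ->
  normal_cone ip C u (- D u - m) -> 0 <= eta ->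
  (forall y w, A y w -> eta * `|y - u| ^+ 2 <= ip (w - m) (y - u)) ->
  [/\ cvg (energy u t @[t --> +oo]), cvg (`|v t| ^+ 2 @[t --> +oo]),
      (\int[mu]_(t in `[0%R, +oo[) (dissipation eta u t)%:E < +oo)%E
    & exists M, forall t, 0 <= t -> energy u t <= M].
Proof.
move=> Bu Aum Nup eta0 mono.
set p := - D u - m in Nup.
(* As [D (x t) + m] equals [(D (x t) - D u) - p], its square is at most twice the sum of the two
   squares: the part in [p] gives the first summand, the other part goes into [D_excess]. *)
pose Q t := 200 * `|p| ^+ 2 * lambda t ^+ 2
  + 20 * (fitz_gap u p t + B_excess u t) + D_excess u t.
have c1 := @cont_fitz_gap u p; have c2 := @cont_B_excess u; have c3 := @cont_D_excess u.
have cQ : continuous Q by rewrite /Q; cts.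
have max0 (r : R) : 0 <= Num.max 0 r by rewrite le_max lexx.
have Q0 t : 0 <= t -> 0 <= Q t.
  have p0 : 0 <= 200 * `|p| ^+ 2 by apply: mulr_ge0 => //; exact: sqr_ge0.
  move=> t0; apply: addr_ge0; last exact: max0.
  apply: addr_ge0; first by apply: mulr_ge0 p0 _; exact: sqr_ge0.
  by apply: mulr_ge0 => //; apply: addr_ge0; exact: max0.
have Qb : prim_bounded Q.
  have b1 : prim_bounded (fun t => 200 * `|p| ^+ 2 * lambda t ^+ 2).
    apply: prim_boundedZ lam_sqr; first by cts.
    by apply: mulr_ge0 => //; exact: sqr_ge0.
  have b2 : prim_bounded (fun t => 20 * (fitz_gap u p t + B_excess u t)).
    apply: prim_boundedZ => //; first by cts.
    by apply: prim_boundedD => //; [exact: fitz|exact: B_excess_bounded].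
  apply: prim_boundedD => //; [by cts| |exact: D_excess_bounded].
  by apply: prim_boundedD => //; cts.
have Qoo := prim_bounded_lty cQ Q0 Qb.
have d0 t : 0 <= t -> 0 <= dissipation eta u t.
  move=> t0; have l0 := ltW (lam0 t0); have lb0 := mulr_ge0 l0 (ltW (bet0 t0)).
  have h2 : 0 <= 20 * eta * lambda t * `|a t + gamma t *: v t + x t - u| ^+ 2.
    by rewrite !mulr_ge0 // sqr_ge0.
  have h3 := mulr_ge0 l0 (ip_D_ge0 u t).
  have h4 := mulr_ge0 lb0 (ip_B_ge0 t Bu).
  have h5 := sqr_ge0 `|v t|; have h6 := sqr_ge0 `|a t|.
  rewrite /dissipation; lra.
have slope : {ae mu, forall t, 0 <= t -> exists2 l : R^o, hder (energy u : R -> R^o) t l &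
    hder v t (a t) /\ l + dissipation eta u t <= Q t}.
  have := energy_slope p Aum eta0 mono; apply: ae_imply => t h t0.
  have [l hl [hv hle]] := h t0; exists l => //; split=> //.
  have mE : D (x t) + m = (D (x t) - D u) - p.
    by rewrite /p opprB opprK addrA addrAC subrK.
  rewrite mE subrK in hle.
  have h2 : `|D (x t) - D u - p| ^+ 2 <= 2 * `|D (x t) - D u| ^+ 2 + 2 * `|p| ^+ 2.
    have := sqr_ge0 `|(D (x t) - D u) + p|.
    rewrite (norm_sqrD ip_norm (D (x t) - D u) p) (norm_sqrB ip_norm (D (x t) - D u)); lra.
  have h3 := ler_wpM2l (sqr_ge0 (lambda t)) h2.
  have h4 : 200 * lambda t ^+ 2 * `|D (x t) - D u| ^+ 2
     - 10 * lambda t * ip (x t - u) (D (x t) - D u) <= D_excess u t.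
    by rewrite le_max lexx orbT.
  rewrite /dissipation /Q; lra.
have E0 t : 0 <= t -> 0 <= energy u t.
  move=> t0; apply: le_trans (energy_ge u t0).
  by rewrite addr_ge0 // mulr_ge0 // sqr_ge0.
have [cE doo EM] : [/\ cvg (energy u t @[t --> +oo]),
      (\int[mu]_(t in `[0%R, +oo[) (dissipation eta u t)%:E < +oo)%E
    & exists M, forall t, 0 <= t -> energy u t <= M].
  apply: (energy_dissipation (energy_lac u) E0 cQ Q0 Qoo d0).
  by apply: ae_imply slope => t h t0; have [l hl [_ hle]] := h t0; exists l.
split=> //.
(* A second Lyapunov function: the derivative 2 <v, a> of |v|^2 is at most |a|^2 + |v|^2 and is
   absorbed by the dissipation. The difference of two convergent functions then gives convergence of
   |v|^2. *)
have [cEV _ _] : [/\ cvg ((energy u t + ip (v t) (v t) : R^o) @[t --> +oo]),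
      (\int[mu]_(t in `[0%R, +oo[) ((0 : R)%:E) < +oo)%E
    & exists M, forall t, 0 <= t -> (energy u t + ip (v t) (v t) : R^o) <= M].
  apply: (@energy_dissipation _ _ Q (fun=> 0)) => //.
  - by apply: lacD; [exact: energy_lac|exact: lac_ip].
  - by move=> t t0; rewrite (ip_sqr ip_norm) addr_ge0 ?sqr_ge0 // E0.
  apply: ae_imply slope => t h t0; have [l hl [hv hle]] := h t0.
  exists (l + (ip (a t) (v t) + ip (v t) (a t))).
    exact: hderD hl (hder_ip ip_norm hv hv).
  rewrite addr0; apply: le_trans hle; rewrite lerD2l [ip (a t) _]ipC.
  have := sqr_ge0 `|v t - a t|; rewrite (norm_sqrB ip_norm) => h1.
  have l0 := ltW (lam0 t0); have lb0 := mulr_ge0 l0 (ltW (bet0 t0)).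
  have h2 : 0 <= 20 * eta * lambda t * `|a t + gamma t *: v t + x t - u| ^+ 2.
    by rewrite !mulr_ge0 // sqr_ge0.
  have h3 := mulr_ge0 l0 (ip_D_ge0 u t).
  have h4 := mulr_ge0 lb0 (ip_B_ge0 t Bu).
  have h5 := sqr_ge0 `|v t|; have h6 := sqr_ge0 `|a t|.
  rewrite /dissipation; lra.
have -> : (fun t => `|v t| ^+ 2) = (fun t => (energy u t + ip (v t) (v t)) - energy u t).
  by apply/funext => t; rewrite addrC addKr (ip_sqr ip_norm).
exact: is_cvgB cEV cE.
Qed.


Hypothesis A_mon : Defs.monotone ip A.

Lemma zer_dissipation u : Z u ->
  [/\ cvg (energy u t @[t --> +oo]), cvg (`|v t| ^+ 2 @[t --> +oo]),
      (\int[mu]_(t in `[0%R, +oo[) (dissipation 0 u t)%:E < +oo)%E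
    & exists M, forall t, 0 <= t -> energy u t <= M].
Proof.
move=> /zerP[Bu [m Aum Nu]]; apply: (dissipation_integrable Bu Aum Nu (lexx 0)).
by move=> y w Ayw; rewrite mul0r; exact: A_mon.
Qed.

Lemma zer_bounded u : Z u -> exists2 M, 0 < M &
  forall t, 0 <= t -> `|x t - u| <= M /\ `|v t| <= M.
Proof.
move=> /zer_dissipation[_ _ _ [M hM]].
have M0 : 0 <= M.
  apply: le_trans (hM 0 (lexx 0)); apply: le_trans (energy_ge u (lexx 0)).
  by rewrite addr_ge0 // mulr_ge0 // sqr_ge0.
exists (M + 1) => [|t t0]; first by lra.
have := le_trans (energy_ge u t0) (hM t t0).
have := sqr_ge0 `|x t - u|; have := sqr_ge0 `|v t|.
have := sqr_ge0 (`|x t - u| - 1); have := sqr_ge0 (`|v t| - 1).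
rewrite !sqrrB !mulr1 !expr1n; split; lra.
Qed.

Lemma dissipation_ge eta u t : B u = 0 -> 0 <= eta -> 0 <= t ->
  [/\ 11 * `|a t| ^+ 2 + 2 * `|v t| ^+ 2
        + 20 * eta * lambda t * `|a t + gamma t *: v t + x t - u| ^+ 2 <= dissipation eta u t,
      `|a t| ^+ 2 <= dissipation eta u t, `|v t| ^+ 2 <= dissipation eta u t,
      lambda t * ip (x t - u) (D (x t) - D u) <= dissipation eta u t
    & lambda t * beta t * ip (x t - u) (B (x t)) <= dissipation eta u t].
Proof.
move=> Bu eta0 t0; have l0 := ltW (lam0 t0); have lb0 := mulr_ge0 l0 (ltW (bet0 t0)).
have h2 : 0 <= 20 * eta * lambda t * `|a t + gamma t *: v t + x t - u| ^+ 2.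
  by rewrite !mulr_ge0 // sqr_ge0.
have h3 := mulr_ge0 l0 (ip_D_ge0 u t).
have h4 := mulr_ge0 lb0 (ip_B_ge0 t Bu).
have h5 := sqr_ge0 `|v t|; have h6 := sqr_ge0 `|a t|.
rewrite /dissipation; split; lra.
Qed.

Lemma integral_le_dissipation eta u (f : R -> R) :
  (\int[mu]_(t in `[0%R, +oo[) (dissipation eta u t)%:E < +oo)%E ->
  (forall t, 0 <= t -> 0 <= f t <= dissipation eta u t) ->
  (\int[mu]_(t in `[0%R, +oo[) (f t)%:E < +oo)%E.
Proof.
move=> doo hf; apply: le_lt_trans doo.
apply: ae_ge0_le_integral_nonmeasurable => [t|t|].
- by rewrite /= in_itv /= andbT lee_fin => /hf/andP[].
- by rewrite /= in_itv /= andbT lee_fin => /hf/andP[]; exact: le_trans.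
by apply: ae_of_all => t; rewrite /= in_itv /= andbT lee_fin => /hf/andP[].
Qed.

(** * Integrability and limits along the trajectory *)

Section zero.
Variable xs : H.
Hypothesis Zxs : Z xs.

Lemma velocity_sqr_lty : (\int[mu]_(t in `[0%R, +oo[) (`|v t| ^+ 2)%:E < +oo)%E.
Proof.
have [_ _ doo _] := zer_dissipation Zxs; have [Bu _] := zerP Zxs.
apply: (integral_le_dissipation doo) => t t0; rewrite sqr_ge0 /=.
by have [] := dissipation_ge Bu (lexx 0) t0.
Qed.

Lemma acceleration_sqr_lty : (\int[mu]_(t in `[0%R, +oo[) (`|a t| ^+ 2)%:E < +oo)%E.
Proof.
have [_ _ doo _] := zer_dissipation Zxs; have [Bu _] := zerP Zxs.
apply: (integral_le_dissipation doo) => t t0; rewrite sqr_ge0 /=.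
by have [] := dissipation_ge Bu (lexx 0) t0.
Qed.

Lemma ip_B_bounded :
  prim_bounded (fun t => lambda t * beta t * ip (x t - xs) (B (x t))).
Proof.
have [_ _ doo _] := zer_dissipation Zxs; have [Bu _] := zerP Zxs.
have f0 t : 0 <= t -> 0 <= lambda t * beta t * ip (x t - xs) (B (x t)).
  by move=> t0; rewrite !mulr_ge0 ?ip_B_ge0 // ltW // ?lam0 ?bet0.
have cB := cBx; apply: lty_prim_bounded => //; first by cts.
apply: (integral_le_dissipation doo) => t t0; rewrite f0 //=.
by have [] := dissipation_ge Bu (lexx 0) t0.
Qed.

Lemma norm_B_bounded : prim_bounded (fun t => lambda t * beta t * `|B (x t)| ^+ 2).
Proof.
have [Bu _] := zerP Zxs; have cB := cBx.
apply: (@prim_bounded_le _ _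
  (fun t => L_B * (lambda t * beta t * ip (x t - xs) (B (x t))))).
- by cts.
- by cts.
- move=> t t0; have lb0 : 0 <= lambda t * beta t by rewrite mulr_ge0 // ltW ?lam0 ?bet0.
  rewrite [leRHS]mulrCA ler_wpM2l // -ler_pdivrMl //; exact: ip_B_ge.
- apply: prim_boundedZ => //; [by cts|exact: ltW|exact: ip_B_bounded].
Qed.

Lemma norm_D_bounded : prim_bounded (fun t => lambda t * `|D (x t) - D xs| ^+ 2).
Proof.
have [_ _ doo _] := zer_dissipation Zxs; have [Bu _] := zerP Zxs.
have f0 t : 0 <= t -> 0 <= lambda t * ip (x t - xs) (D (x t) - D xs).
  by move=> t0; rewrite !mulr_ge0 ?ip_D_ge0 // ltW // lam0.
have cD := cDx; have bD : prim_bounded (fun t => lambda t * ip (x t - xs) (D (x t) - D xs)).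
  apply: lty_prim_bounded => //; first by cts.
  apply: (integral_le_dissipation doo) => t t0; rewrite f0 //=.
  by have [] := dissipation_ge Bu (lexx 0) t0.
apply: (@prim_bounded_le _ _
  (fun t => L_D * (lambda t * ip (x t - xs) (D (x t) - D xs)))).
- by cts.
- by cts.
- move=> t t0; rewrite [leRHS]mulrCA ler_wpM2l ?(ltW (lam0 t0)) // -ler_pdivrMl //.
  exact: ip_D_ge.
- apply: prim_boundedZ => //; [by cts|exact: ltW].
Qed.

Lemma prim1_unbounded (M : R) : exists2 t, 0 <= t & M < prim (fun=> 1) t.
Proof.
exists (`|M| + 1); first by have := normr_ge0 M; lra.
have h : 1 * (`|M| + 1 - 0) <= prim (fun=> 1) (`|M| + 1) - prim (fun=> 1) 0 :> R.
  by apply: prim_incr_ge => //; exact: ctsC.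
by rewrite prim0 in h; have := ler_norm M; lra.
Qed.

Lemma velocity_cvg0 : v t @[t --> +oo] --> 0.
Proof.
have [_ cvV _ _] := zer_dissipation Zxs.
have /cvg_ex[l hl] := cvV.
have l0 : l <= 0.
  have cV : continuous (fun t => `|v t| ^+ 2) by cts.
  have c1 : continuous (fun _ : R => 1 : R) by exact: ctsC.
  have f0 t : 0 <= t -> 0 <= `|v t| ^+ 2 by move=> _; exact: sqr_ge0.
  apply: (weighted_cvg_le0 c1 cV _ prim1_unbounded f0 _ hl) => //.
  under eq_fun do rewrite mul1r.
  apply: lty_prim_bounded => //.
  exact: velocity_sqr_lty.
apply/cvgr0Pnorm_lt => e e0.
have e20 : 0 < e ^+ 2 by rewrite exprn_gt0.
have /cvgrPdist_lt/(_ _ e20) h := hl.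
have aux (y : R) : `|l - y ^+ 2| < e ^+ 2 -> `|y| < e.
  rewrite ltr_norml => /andP[h1 _].
  suff h2 : `|y| ^+ 2 < e ^+ 2 by rewrite -(@ltr_pXn2r _ 2) ?nnegrE // ltW.
  by rewrite real_normK ?num_real //; lra.
by apply: filterS h => t /aux; rewrite normr_id.
Qed.

End zero.

Lemma ip_velocity_cvg0 u : Z u -> ip (x t - u) (v t) @[t --> +oo] --> 0.
Proof.
move=> Zu; have [M M0 hM] := zer_bounded Zu; have v0 := velocity_cvg0 Zu.
apply/cvgr0Pnorm_lt => e e0.
have e'0 : 0 < e / M by rewrite divr_gt0.
have /cvgr0Pnorm_lt/(_ _ e'0) hv := v0.
near=> t; have t0 : 0 <= t by near: t; apply: nbhs_pinfty_ge; exact: num_real.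
apply: le_lt_trans (ip_normM ip_norm _ _) _.
have h1 : `|v t| < e / M by near: t; exact: hv.
have [h2 _] := hM t t0.
apply: (@le_lt_trans _ _ (M * `|v t|)); first by rewrite ler_wpM2r.
by rewrite mulrC -ltr_pdivlMr.
Unshelve. all: by end_near. Qed.

(** The terms of the energy involving the velocity vanish in the limit, and [gamma] decreases to a
    positive limit, so the limit of the energy determines that of the squared distance. *)
Lemma distance_cvg u : Z u -> cvg (`|x t - u| @[t --> +oo]).
Proof.
move=> Zu; have [cE _ _ _] := zer_dissipation Zu.
have v0 := velocity_cvg0 Zu.
have cgam : cvg (gamma t @[t --> +oo]).
  apply: (@nonincreasing_cvg_pinfty _ _ 0); first exact: gamma_nonincreasing.
  by move=> t /gamma_bounds[h _]; lra.
have /cvg_ex[g hg] := cgam; have /cvg_ex[E hE] := cE.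
have g1 : 1 <= g.
  apply: (ler_cvg_to (cvg_cst (1 : R)) hg).
  near=> t; have t0 : 0 <= t by near: t; apply: nbhs_pinfty_ge; exact: num_real.
  by have [h _] := gamma_bounds t0; lra.
have ip0 := ip_velocity_cvg0 Zu.
have V0 : ip (v t) (v t) @[t --> +oo] --> 0.
  by rewrite -(linear0l ip 0); exact: cvg_ip.
have xE : (fun t => `|x t - u| ^+ 2) @ +oo -->
    10^-1 * (g^-1 * (E - 20 * 0) - 11 * 0).
  have : (fun t => 10^-1 * ((gamma t)^-1 * (energy u t - 20 * ip (x t - u) (v t))
      - 11 * ip (v t) (v t))) @ +oo --> 10^-1 * (g^-1 * (E - 20 * 0) - 11 * 0).
    apply: cvgMr; apply: cvgB; last exact: cvgMr.
    apply: cvgM; first by apply: cvgV => //; lra.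
    by apply: cvgB => //; exact: cvgMr.
  apply: cvg_trans; apply: near_eq_cvg; near=> t.
  have t0 : 0 <= t by near: t; apply: nbhs_pinfty_ge; exact: num_real.
  have gt0 : gamma t != 0 by have [h _] := gamma_bounds t0; apply/eqP; lra.
  by rewrite /energy !(ip_sqr ip_norm); field.
have -> : (fun t => `|x t - u|) = (fun t => Num.sqrt (`|x t - u| ^+ 2)).
  by apply/funext => t; rewrite sqrtr_sqr normr_id.
apply/cvg_ex; eexists; apply: (@cvg_comp _ _ _ (fun t => `|x t - u| ^+ 2) Num.sqrt).
  exact: xE.
exact: sqrt_continuous.
Unshelve. all: by end_near. Qed.


(** * Weak convergence of the averages *)

Hypothesis ANC_max : maximally_monotone ip (op_add A (normal_cone ip C)).
Variable xs : H.
Hypothesis Zxs : Z xs.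

Lemma zer_trajectory_bound u : exists2 M, 0 < M & forall t, 0 <= t -> `|x t - u| <= M.
Proof.
have [M M0 hM] := zer_bounded Zxs; exists (M + `|xs - u|).
  by rewrite ltr_pwDl.
move=> t t0; rewrite -(subrK xs (x t)) -addrA.
by apply: (le_trans (ler_normD _ _)); rewrite lerD2r; have [] := hM t t0.
Qed.

(** Boundedness of the trajectory bounds [D (x t) + m] by [K], so its contribution is a multiple of
    the integrable [lambda t ^+ 2]; comparison of the energy with a primitive then leaves an upper
    bound on the pairing. *)
Lemma graph_bounded u m p : A u m -> normal_cone ip C u p ->
  prim_bounded (fun t => lambda t * ip (x t - u) (D (x t) + m + p)).
Proof.
move=> Aum Nup; have Bu : B u = 0 by have [] := Nup.
have [M M0 hM] := zer_trajectory_bound u.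
have cD := cDx; have cf := @cont_fitz_gap u p; have cB := @cont_B_excess u.
pose K := L_D * M + `|D u + m|.
have DK t : 0 <= t -> `|D (x t) + m| <= K.
  move=> t0; have -> : D (x t) + m = (D (x t) - D u) + (D u + m) by rewrite addrA subrK.
  apply: (le_trans (ler_normD _ _)); rewrite lerD2r.
  apply: (le_trans (cocoercive_lipschitz ip_norm L_D0 D_coco _ _)).
  by rewrite ler_wpM2l ?hM // ltW.
pose G t := 100 * K ^+ 2 * lambda t ^+ 2 + 20 * (fitz_gap u p t + B_excess u t).
pose F t := 20 * (lambda t * ip (x t - u) (D (x t) + m + p)).
have cG : continuous G by rewrite /G; cts.
have cF : continuous F by rewrite /F; cts.
have [KG hG] : prim_bounded G.
  apply: prim_boundedD; [by cts|by cts| |].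
    by apply: prim_boundedZ => //; [cts|rewrite mulr_ge0 ?sqr_ge0].
  apply: prim_boundedZ => //; first by cts.
  by apply: prim_boundedD => //; [exact: fitz|exact: B_excess_bounded].
have cGF : continuous (fun t => G t - F t) by cts.
have slope : {ae mu, forall t, 0 <= t ->
    exists2 l : R^o, hder (energy u : R -> R^o) t l & l <= G t - F t}.
  have mono y w : A y w -> 0 * `|y - u| ^+ 2 <= ip (w - m) (y - u).
    by move=> Ayw; rewrite mul0r; exact: A_mon.
  have := energy_slope p Aum (lexx 0) mono; apply: ae_imply => t h t0.
  have [l hl [_ hle]] := h t0; exists l => //.
  have l0 := ltW (lam0 t0); have lb0 := mulr_ge0 l0 (ltW (bet0 t0)).
  have h4 := mulr_ge0 lb0 (ip_B_ge0 t Bu).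
  have h5 := sqr_ge0 `|v t|; have h6 := sqr_ge0 `|a t|.
  have h7 : lambda t ^+ 2 * `|D (x t) + m| ^+ 2 <= lambda t ^+ 2 * K ^+ 2.
    rewrite ler_wpM2l ?sqr_ge0 // ler_pXn2r ?DK // nnegrE //.
    exact: le_trans (normr_ge0 _) (DK t t0).
  rewrite mulr0 !mul0r in hle; rewrite /G /F; lra.
exists ((KG + energy u 0) / 20) => t t0.
have := hder_le_prim (energy_lac u) cGF slope (lexx 0) t0.
rewrite prim0 primB // /F primZ; last by cts.
have := hG t t0.
have : 0 <= energy u t.
  apply: le_trans (energy_ge u t0).
  by rewrite addr_ge0 // mulr_ge0 // sqr_ge0.
lra.
Qed.

(* The upper limit of the lambda-averages of f is at most 0. *)
Definition avg_small (f : R -> R) : Prop :=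
  forall e, 0 < e -> prim_bounded (fun t => lambda t * (f t - e)).

(** Young's inequality M d <= M^2 / (4 e) d^2 + e, where d is the norm of [D (x t) - D xs];
    [norm_D_bounded] takes care of the square. *)
Lemma avg_small_D u : avg_small (fun t => `|ip (x t - u) (D (x t) - D xs)|).
Proof.
move=> e e0; have [M M0 hM] := zer_trajectory_bound u; have cD := cDx.
apply: (@prim_bounded_le _ _
  (fun t => M ^+ 2 / (4 * e) * (lambda t * `|D (x t) - D xs| ^+ 2))).
- by cts.
- by cts.
- move=> t t0; rewrite [leRHS]mulrCA ler_wpM2l ?(ltW (lam0 t0)) //.
  have h1 : `|ip (x t - u) (D (x t) - D xs)| <= M * `|D (x t) - D xs|.
    by apply: (le_trans (ip_normM ip_norm _ _)); rewrite ler_wpM2r // hM.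
  have := sqr_ge0 (M * `|D (x t) - D xs| - 2 * e).
  set d := `|D (x t) - D xs| in h1 *; rewrite sqrrB => h2.
  rewrite lerBlDr; apply: (le_trans h1).
  rewrite mulrAC -lerBlDr ler_pdivlMr; last by rewrite mulr_gt0.
  lra.
- apply: prim_boundedZ; [by cts| |exact: norm_D_bounded].
  by rewrite divr_ge0 ?sqr_ge0 // mulr_ge0 // ltW.
Qed.

Lemma avg_small_le (f g : R -> R) : continuous f -> continuous g ->
  (forall t, 0 <= t -> f t <= g t) -> avg_small g -> avg_small f.
Proof.
move=> cf cg fg sg e e0; apply: prim_bounded_le (sg e e0); [by cts|by cts|].
by move=> t t0; rewrite ler_wpM2l ?(ltW (lam0 t0)) // lerD2r fg.
Qed.

(** Replacing [D (x t)] by the constant [D xs] costs a term that is small on average and leaves a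
    pairing affine in [x t], which passes to weak limits of averages. *)
Lemma avg_small_graph u m p : A u m -> normal_cone ip C u p ->
  avg_small (fun t => ip (x t - u) (D xs + m + p)).
Proof.
move=> Aum Nup e e0; have cD := cDx.
apply: (@prim_bounded_le _ _
  (fun t => lambda t * ip (x t - u) (D (x t) + m + p)
     + lambda t * (`|ip (x t - u) (D (x t) - D xs)| - e))).
- by cts.
- by cts.
- move=> t t0; rewrite -mulrDr ler_wpM2l ?(ltW (lam0 t0)) // addrA lerD2r.
  rewrite -lerBlDl -ipBr; apply: (le_trans (ler_norm _)).
  rewrite -normrN -ipNr opprB.
  have -> : D (x t) + m + p - (D xs + m + p) = D (x t) - D xs.
    by rewrite -![_ + m + p]addrA opprD addrACA subrr addr0.
  exact: lexx.
apply: prim_boundedD; [by cts|by cts|exact: graph_bounded|exact: avg_small_D].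
Qed.

Lemma avg_small_monotone y : avg_small (fun t => ip (x t - y) (D y - D xs)).
Proof.
have cD := cDx.
apply: (@avg_small_le _ (fun t => `|ip (x t - y) (D (x t) - D xs)|)).
- by cts.
- by cts.
- move=> t t0; have := ip_D_ge0 y t.
  have -> : D (x t) - D y = (D (x t) - D xs) - (D y - D xs).
    by rewrite opprB addrA subrK.
  by rewrite ipBr subr_ge0 => /le_trans; apply; exact: ler_norm.
exact: avg_small_D.
Qed.

Lemma avg_small_cvg (f : R -> R) l : continuous f -> f t @[t --> +oo] --> l ->
  avg_small (fun t => f t - l).
Proof.
move=> cf fl e e0.
have /cvgrPdist_lt/(_ _ e0)[T [_ hT]] := fl.
apply: (@prim_bounded_npos _ _ (Num.max 0 (T + 1))); first by cts.
move=> t; rewrite ge_max => /andP[t0 Tt].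
have Tt' : T < t by lra.
have := hT t Tt'; rewrite distrC ltr_norml => /andP[_ h].
by rewrite mulr_ge0_le0 ?(ltW (lam0 t0)) // subr_le0 ltW.
Qed.

Definition average (t : R) : H :=
  (prim lambda t)^-1 *: bochner_integral `[0, t] (fun s => lambda s *: x s).

Lemma near_prim_lambda_gt K : \forall t \near +oo, K < prim lambda t.
Proof.
have [T T0 hT] := lam_inf K; near=> t.
have Tt : T <= t by near: t; apply: nbhs_pinfty_ge; exact: num_real.
apply: lt_le_trans hT _; apply: prim_nondecreasing => // s s0.
by rewrite ltW ?lam0.
Unshelve. all: by end_near. Qed.

Lemma average_ip t y : 0 <= t ->
  ip (average t) y = (prim lambda t)^-1 * prim (fun s => lambda s * ip (x s) y) t.
Proof.
move=> t0; rewrite ipZl (bochner_integral_ip ip_norm) //; last by cts.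
by congr (_ * prim _ t); apply/funext => s; rewrite ipZl.
Qed.

(** Pairing the average with itself reduces the norm bound to an inequality between scalar
    primitives. *)
Lemma average_bounded : exists M, \forall t \near +oo, `|average t| <= M.
Proof.
have [M M0 hM] := zer_trajectory_bound 0; exists M; near=> t.
have t0 : 0 <= t by near: t; apply: nbhs_pinfty_ge; exact: num_real.
have P0 : 0 < prim lambda t by near: t; exact: near_prim_lambda_gt.
have [->|n0] := eqVneq (`|average t|) 0; first exact: ltW.
have {}n0 : 0 < `|average t| by rewrite lt0r n0 normr_ge0.
rewrite -(ler_pM2r n0) -expr2 -(ip_sqr ip_norm) average_ip // ler_pdivrMl //.
have -> : prim lambda t * (M * `|average t|) =
    prim (fun s => M * `|average t| * lambda s) t by rewrite primZ // mulrC.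
apply: le_prim; [by cts|by cts|move=> s /andP[s0 _]].
rewrite mulrC ler_wpM2r ?(ltW (lam0 s0)) //; apply: (le_trans (ip_le ip_norm _ _)).
by rewrite ler_wpM2r //; have := hM s s0; rewrite subr0.
Unshelve. all: by end_near. Qed.

Lemma weak_cluster_le (U : set_system R) z u w (c : R) : ProperFilter U -> +oo `<=` U ->
  weak_limit ip average U z -> avg_small (fun t => ip (x t - u) w - c) ->
  ip (z - u) w <= c.
Proof.
move=> PU Uoo Uz sm; apply/ler_addgt0Pr => e e0.
have e20 : 0 < e / 2 by rewrite divr_gt0.
have [K hK] := sm _ e20.
have lim : ip (average t - u) w @[t --> U] --> ip (z - u) w.
  under eq_fun do rewrite ipBl; rewrite ipBl.
  by apply: cvgB; [exact: Uz|exact: cvg_cst].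
apply: (ler_cvg_to lim (cvg_cst (c + e))); apply: Uoo; near=> t.
have t0 : 0 <= t by near: t; apply: nbhs_pinfty_ge; exact: num_real.
have P0 : 0 < prim lambda t by near: t; exact: near_prim_lambda_gt.
(* Makes the contribution of [K] to the average smaller than [e / 2]; the other half of [e] was
   spent in [sm]. *)
have P1 : 2 * K / e < prim lambda t by near: t; exact: near_prim_lambda_gt.
rewrite ltr_pdivrMr // in P1.
have := hK t t0.
have -> : (fun t => lambda t * (ip (x t - u) w - c - e / 2)) =
    (fun t => lambda t * ip (x t) w - (ip u w + c + e / 2) * lambda t).
  by apply/funext => s; rewrite ipBl; ring.
rewrite primB ?primZ //; [|by cts|by cts].
move=> hKt; rewrite ipBl average_ip // lerBlDr ler_pdivrMl //.
move: hKt; set I := prim (fun s => lambda s * ip (x s) w) t; nra.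
Unshelve. all: by end_near. Qed.

Lemma weak_cluster_zer (U : set_system R) z : ProperFilter U -> +oo `<=` U ->
  weak_limit ip average U z -> Z z.
Proof.
move=> PU Uoo Uz.
have sub0 f : avg_small f -> avg_small (fun t => f t - 0).
  by move=> sf e e0; under eq_fun do rewrite subr0; exact: sf.
have gr_z u m p : A u m -> normal_cone ip C u p -> ip (z - u) (D xs + m + p) <= 0.
  move=> Aum Nup; apply: (weak_cluster_le PU Uoo Uz).
  by apply: sub0; exact: avg_small_graph.
have D_z y : ip (z - y) (D y - D xs) <= 0.
  apply: (weak_cluster_le PU Uoo Uz).
  by apply: sub0; exact: avg_small_monotone.
(* Minty's argument at the point [z - s *: e]. With [s] equal to 1 / (2 L_D) the Lipschitz bound
   already gives |e|^2 <= |e|^2 / 2, so no limit in [s] is taken. *)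
have Dz : D z = D xs.
  apply/eqP; rewrite -subr_eq0 -normr_eq0 -sqrf_eq0 eq_le sqr_ge0 andbT.
  set e := D z - D xs.
  pose s := (2 * L_D)^-1.
  have s0 : 0 < s by rewrite invr_gt0 mulr_gt0.
  have := D_z (z - s *: e).
  rewrite opprB addrCA subrr addr0 ipZl pmulr_rle0 //.
  have -> : D (z - s *: e) - D xs = e - (D z - D (z - s *: e)).
    by rewrite /e opprB [RHS]addrC addrA subrK.
  rewrite ipBr (ip_sqr ip_norm) subr_le0 => /le_trans h.
  have : `|e| ^+ 2 <= 1 / 2 * `|e| ^+ 2.
    apply: h; apply: (le_trans (ip_le ip_norm _ _)).
    have := cocoercive_lipschitz ip_norm L_D0 D_coco z (z - s *: e).
    rewrite opprB addrCA subrr addr0 normrZ gtr0_norm // => h2.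
    apply: (@le_trans _ _ (`|e| * (L_D * (s * `|e|)))); first by rewrite ler_wpM2l.
    have sE : L_D * s = 1 / 2 by rewrite /s; field; rewrite gt_eqF.
    by rewrite [L_D * _]mulrA sE expr2 mulrCA.
  lra.
(* The graph of A + N_C enlarged by the single point [(z, - D xs)]; [gr_z] makes the enlargement
   monotone, so maximality places this point in the original graph. *)
pose S y := op_add A (normal_cone ip C) y `|` [set w | y = z /\ w = - D xs].
have [Mmon Mmax] := ANC_max.
have gz y w : op_add A (normal_cone ip C) y w -> 0 <= ip (- D xs - w) (z - y).
  move=> [m [p [Aym Nyp ->]]]; have := gr_z _ _ _ Aym Nyp.
  by rewrite -opprD ipNl oppr_ge0 ipC addrA.
have Smon : Defs.monotone ip S.
  move=> y w y' w'; rewrite /gr /= => -[h|[-> ->]] [h'|[-> ->]].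
  - exact: Mmon.
  - by rewrite -(opprB (- D xs) w) -(opprB z y) ipNl ipNr opprK; exact: gz.
  - exact: gz.
  - by rewrite subrr linear0l.
have : gr (op_add A (normal_cone ip C)) (z, - D xs).
  by apply: (Mmax S Smon) => [[y w] h|]; [left|right].
move=> [m [p [Azm Nzp E]]]; exists (m + D z), p; split=> //.
  by exists m, (D z).
by rewrite addrAC -E Dz addNr.
Qed.

(** The difference of the squared distances to [z1] and [z2] is affine in [x t], so
    [ip (x t) (z1 - z2)] converges. Its averages have the same limit, hence [z1] and [z2] have equal
    pairings with their difference. *)
Lemma weak_cluster_unique (U1 U2 : set_system R) z1 z2 :
  ProperFilter U1 -> ProperFilter U2 -> +oo `<=` U1 -> +oo `<=` U2 ->
  weak_limit ip average U1 z1 -> weak_limit ip average U2 z2 -> z1 = z2.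
Proof.
move=> P1 P2 O1 O2 W1 W2.
have /distance_cvg/cvg_ex[l1 h1] := weak_cluster_zer P1 O1 W1.
have /distance_cvg/cvg_ex[l2 h2] := weak_cluster_zer P2 O2 W2.
pose w := z1 - z2.
pose l := 2^-1 * (l2 * l2 - l1 * l1 + (`|z1| ^+ 2 - `|z2| ^+ 2)).
have hl : ip (x t) w @[t --> +oo] --> l.
  have : 2^-1 * (`|x t - z2| * `|x t - z2| - `|x t - z1| * `|x t - z1|
      + (`|z1| ^+ 2 - `|z2| ^+ 2)) @[t --> +oo] --> l.
    apply: cvgMr; apply: cvgD; last exact: cvg_cst.
    by apply: cvgB; exact: cvgM.
  apply: cvg_trans; apply: near_eq_cvg; apply: nearW => t.
  by rewrite -!expr2 !(norm_sqrB ip_norm) /w ipBr; field.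
have cw : continuous (fun t => ip (x t) w) by cts.
have key (U : set_system R) z : ProperFilter U -> +oo `<=` U ->
    weak_limit ip average U z -> ip z w = l.
  move=> PU OU WU; apply/eqP; rewrite eq_le; apply/andP; split.
    have := @weak_cluster_le U z 0 w l PU OU WU.
    rewrite subr0; apply => e e0; under eq_fun do rewrite subr0.
    exact: avg_small_cvg.
  have sm : avg_small (fun t => ip (x t) (- w) - - l).
    apply: avg_small_cvg; first by cts.
    by under eq_fun do rewrite ipNr; exact: cvgN.
  have := @weak_cluster_le U z 0 (- w) (- l) PU OU WU.
  rewrite subr0 ipNr lerN2; apply => e e0.
  by have := sm e e0; under [in X in _ -> X]eq_fun do rewrite subr0.
apply/eqP; rewrite -subr_eq0 -normr_eq0 -sqrf_eq0 -(ip_sqr ip_norm) -/w {1}/w ipBl.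
by rewrite (key U1) // (key U2) // subrr.
Qed.

Lemma average_weak_cvg : exists2 z, Z z & weak_limit ip average +oo z.
Proof.
have [M hM] := average_bounded.
apply: (weak_limit_from_ultra ip_norm _ hM).
- move=> U z UU; have PU : ProperFilter U by exact: (@ultra_proper _ _ UU).
  exact: weak_cluster_zer.
- move=> U1 U2 z1 z2 UU1 UU2.
  have PU1 : ProperFilter U1 by exact: (@ultra_proper _ _ UU1).
  have PU2 : ProperFilter U2 by exact: (@ultra_proper _ _ UU2).
  exact: weak_cluster_unique.
Qed.


(** * Strong convergence under strong monotonicity *)

Lemma lambda_bounded : exists2 L, 0 < L & forall t, 0 <= t -> lambda t <= L.
Proof.
have [T hT] := lam_cvg0 ltr01.
have [M M0 hM] := continuous_bounded_itv 0 T (cl : continuous (lambda : R -> R^o)).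
exists (M + 1) => [|t t0]; first by lra.
have [tT|/ltW/hT] := leP t T; last by lra.
have /hM h : 0 <= t <= T by rewrite t0.
by apply: le_trans (ler_norm _) _; lra.
Qed.

(** Strong monotonicity controls the squared distance to [u] from the resolvent point rather than
    from [x t]; the integrable |a|^2 and |v|^2 bridge the two. Then [lambda t * |x t - u|^2] is
    integrable although [lambda] is not, so the limit of the distance is 0. *)
Lemma strong_cvg eta u : 0 < eta ->
  (forall y w y' w', A y w -> A y' w' -> eta * `|y - y'| ^+ 2 <= ip (w - w') (y - y')) ->
  Z u -> x t @[t --> +oo] --> u.
Proof.
move=> eta0 mono Zu; have [Bu [m Aum Nu]] := zerP Zu.
have mono' y w : A y w -> eta * `|y - u| ^+ 2 <= ip (w - m) (y - u).
  by move=> Ayw; exact: mono.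
have [_ _ doo _] := dissipation_integrable Bu Aum Nu (ltW eta0) mono'.
have [L L0 hL] := lambda_bounded.
pose g0 := gamma 0.
(* With [c] equal to 1 / (2 K), one has [c <= eta] while [c * L] and [c * (L * g0 ^+ 2)] are at most
   1/2; the terms to absorb are then at most twice eta lambda W, |a|^2 and |v|^2, which the
   dissipation contains. *)
pose K := eta^-1 + L + L * g0 ^+ 2.
have Lg0 : 0 <= L * g0 ^+ 2 by rewrite mulr_ge0 ?sqr_ge0 // ltW.
have ei0 : 0 < eta^-1 by rewrite invr_gt0.
have K0 : 0 < K by rewrite /K; lra.
pose c := (2 * K)^-1.
have c0 : 0 < c by rewrite invr_gt0 mulr_gt0.
have cK : c * K = 1 / 2 by rewrite /c; field; rewrite gt_eqF.
have ce : c <= eta.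
  have : c * eta^-1 <= 1 / 2 by rewrite -cK ler_pM2l // /K; lra.
  by rewrite ler_pdivrMr //; lra.
have cL : c * L <= 1 / 2 by rewrite -cK ler_pM2l // /K; lra.
have cLg : c * (L * g0 ^+ 2) <= 1 / 2 by rewrite -cK ler_pM2l // /K; lra.
have bound t : 0 <= t -> 0 <= c * (lambda t * `|x t - u| ^+ 2) <= dissipation eta u t.
  move=> t0; have l0 := ltW (lam0 t0); have lL := hL t t0.
  rewrite !mulr_ge0 ?sqr_ge0 ?(ltW c0) //=.
  have [h1 _ _ _ _] := dissipation_ge Bu (ltW eta0) t0; apply: le_trans h1.
  set q := a t + gamma t *: v t.
  have xE : x t - u = (q + x t - u) - q by rewrite -[q + x t - u]addrA [RHS]addrC addKr.
  have h2 : `|x t - u| ^+ 2 <= 2 * `|q + x t - u| ^+ 2 + 2 * `|q| ^+ 2.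
    rewrite [in leLHS]xE; have := sqr_ge0 `|(q + x t - u) + q|.
    rewrite (norm_sqrD ip_norm (q + x t - u) q).
    rewrite (norm_sqrB ip_norm (q + x t - u) q); lra.
  have h3 : `|q| ^+ 2 <= 2 * `|a t| ^+ 2 + 2 * (g0 ^+ 2 * `|v t| ^+ 2).
    have := sqr_ge0 `|a t - gamma t *: v t|.
    rewrite /q (norm_sqrD ip_norm (a t)) (norm_sqrB ip_norm (a t)) normrZ exprMn.
    rewrite real_normK ?num_real //.
    have : gamma t ^+ 2 * `|v t| ^+ 2 <= g0 ^+ 2 * `|v t| ^+ 2.
      have [h _] := gamma_bounds t0; have gg := gamma_nonincreasing (lexx 0) t0.
      rewrite ler_wpM2r ?sqr_ge0 // ler_pXn2r ?nnegrE //; rewrite /g0; lra.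
    lra.
  set X := `|x t - u| ^+ 2 in h2 *; set W := `|q + x t - u| ^+ 2 in h2 *.
  set q2 := `|q| ^+ 2 in h2 h3; set V := `|v t| ^+ 2 in h3 *.
  set Ac := `|a t| ^+ 2 in h3 *.
  have W0 : 0 <= W by exact: sqr_ge0.
  have V0 : 0 <= V by exact: sqr_ge0.
  have Ac0 : 0 <= Ac by exact: sqr_ge0.
  have q20 : 0 <= q2 by exact: sqr_ge0.
  have cl0 : 0 <= c * lambda t by rewrite mulr_ge0 // ltW.
  have k1 : c * lambda t * X <= c * lambda t * (2 * W + 2 * q2) by rewrite ler_wpM2l.
  have k2 : c * lambda t * W <= eta * (lambda t * W).
    by rewrite -mulrA ler_wpM2r // mulr_ge0.
  have k3 : c * lambda t * q2 <= c * L * q2 by rewrite ler_wpM2r // ler_wpM2l // ltW.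
  have k4 : c * L * q2 <= c * L * (2 * Ac + 2 * (g0 ^+ 2 * V)).
    by rewrite ler_wpM2l // mulr_ge0 // ltW.
  have k5 : c * L * Ac <= 1 / 2 * Ac by rewrite ler_wpM2r.
  have k7 : 0 <= eta * (lambda t * W) by rewrite mulr_ge0 ?mulr_ge0 // ltW.
  have k6 : c * (L * g0 ^+ 2) * V <= 1 / 2 * V by rewrite ler_wpM2r.
  lra.
have cXu : continuous (fun t => `|x t - u| ^+ 2) by cts.
have Xb : prim_bounded (fun t => lambda t * `|x t - u| ^+ 2).
  have cX : continuous (fun t => c * (lambda t * `|x t - u| ^+ 2)) by cts.
  have h : prim_bounded (fun t => c * (lambda t * `|x t - u| ^+ 2)).
    apply: lty_prim_bounded => // [t /bound/andP[] //|].
    exact: (integral_le_dissipation doo bound).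
  have := prim_boundedZ cX (_ : 0 <= c^-1) h; rewrite invr_ge0 => /(_ (ltW c0)).
  by under eq_fun do rewrite mulKf ?gt_eqF //.
have /distance_cvg/cvg_ex[l hl] := Zu.
have hl2 : `|x t - u| ^+ 2 @[t --> +oo] --> l * l.
  by under eq_fun do rewrite expr2; exact: cvgM.
have X0 t : 0 <= t -> 0 <= `|x t - u| ^+ 2 by move=> _; exact: sqr_ge0.
have ll0 : l * l <= 0.
  by apply: (weighted_cvg_le0 cl cXu _ lam_inf X0 Xb hl2) => t /lam0/ltW.
have lE : l = 0.
  by apply/eqP; rewrite -sqrf_eq0 eq_le sqr_ge0 expr2 ll0.
apply/cvgrPdist_lt => e e0; move: hl; rewrite lE => /cvgr0Pnorm_lt/(_ _ e0).
by apply: filterS => t; rewrite normr_id distrC.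
Qed.


Lemma trajectory_convergence :
  [/\ forall u, Z u -> cvg (`|x t - u| @[t --> +oo]),
      (\int[mu]_(t in `[0%R, +oo[) (`|v t| ^+ 2)%:E < +oo)%E /\
        (\int[mu]_(t in `[0%R, +oo[) (`|a t| ^+ 2)%:E < +oo)%E,
      prim_bounded (fun t => lambda t * beta t * `|B (x t)| ^+ 2) /\
        forall u, Z u ->
          prim_bounded (fun t => lambda t * beta t * ip (x t - u) (B (x t))),
      v t @[t --> +oo] --> 0 /\
        forall u, Z u -> ip (x t - u) (v t) @[t --> +oo] --> 0
    & (exists2 z, Z z & weak_limit ip average +oo z) /\
      forall eta u, 0 < eta ->
        (forall y w y' w', A y w -> A y' w' ->
          eta * `|y - y'| ^+ 2 <= ip (w - w') (y - y')) ->
        Z u -> x t @[t --> +oo] --> u].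
Proof.
split; [exact: distance_cvg|split|split|split|split].
- exact: velocity_sqr_lty Zxs.
- exact: acceleration_sqr_lty Zxs.
- exact: norm_B_bounded Zxs.
- exact: ip_B_bounded.
- exact: velocity_cvg0 Zxs.
- exact: ip_velocity_cvg0.
- exact: average_weak_cvg.
- exact: strong_cvg.
Qed.

End trajectory.

(** * Restriction to the half-line *)

Section restriction.
Context {R : realType}.
Local Notation mu := (@lebesgue_measure R).

Lemma eq_locally_abs_continuous {V : normedModType R} (f g : R -> V) :
  (forall t, 0 <= t -> f t = g t) -> locally_abs_continuous f ->
  locally_abs_continuous g.
Proof.
move=> fg acf b b0 e e0; have [d d0 h] := acf b b0 e e0.
exists d => // n l r lr tr s; have := h n l r lr tr s.
congr (_ < _); apply: eq_bigr => i _; have [l0 lri _] := lr i.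
by rewrite !fg // (le_trans l0).
Qed.

Lemma eq_half_line_lty (f g : R -> R) : (forall t, 0 <= t -> f t = g t) ->
  (\int[mu]_(t in `[0%R, +oo[) (f t)%:E < +oo)%E ->
  (\int[mu]_(t in `[0%R, +oo[) (g t)%:E < +oo)%E.
Proof.
move=> fg; suff -> : (\int[mu]_(t in `[0%R, +oo[) (g t)%:E =
    \int[mu]_(t in `[0%R, +oo[) (f t)%:E)%E by [].
apply: eq_integral => t; rewrite inE /= in_itv /= andbT => t0.
by rewrite fg.
Qed.

Lemma integrable_half_line (f g : R -> R) : continuous f ->
  (forall t, 0 <= t -> 0 <= f t) -> (forall t, 0 <= t -> f t = g t) ->
  prim_bounded f -> mu.-integrable `[0, +oo[ (EFin \o g).
Proof.
move=> cf f0 fg bf.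
have mf : measurable_fun (`[0, +oo[ : set R) (EFin \o f).
  by apply/measurable_EFinP; apply: measurable_funTS; exact: continuous_measurable_fun.
apply: (@eq_integrable _ _ _ mu _ _ (EFin \o f)) => //.
  by move=> t; rewrite inE /= in_itv /= andbT => t0; rewrite fg.
apply/integrableP; split => //.
apply: le_lt_trans (prim_bounded_lty cf f0 bf).
apply: ae_ge0_le_integral_nonmeasurable => [t _|t|] //.
  by rewrite /= in_itv /= andbT lee_fin; exact: f0.
apply: ae_of_all => t; rewrite /= in_itv /= andbT => t0.
by rewrite ger0_norm // f0.
Qed.

Lemma eq_bochner_integral {V : normedModType R} (D : set R) (f g : R -> V) :
  (forall t, D t -> f t = g t) -> bochner_integral D f = bochner_integral D g.
Proof.
have sub (f1 f2 : R -> V) v : (forall t, D t -> f1 t = f2 t) ->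
    is_bochner_integral D f1 v -> is_bochner_integral D f2 v.
  move=> f12 [[s [ss sf]] [s' [h1 h2 h3]]]; split.
    by exists s; split=> //; apply: ae_imply sf => t h Dt; rewrite -f12 //; exact: h.
  exists s'; split=> //; apply: cvg_trans h2; apply: near_eq_cvg; apply: nearW => n.
  by apply: eq_integral => t /set_mem Dt; rewrite f12.
move=> fg; rewrite /bochner_integral; congr (xget 0 _).
apply/seteqP; split => v /=; apply: sub => // t Dt; by rewrite fg.
Qed.

Lemma near_pinfty_ge0 : \forall t \near +oo%R, (0 : R) <= t.
Proof. by apply: nbhs_pinfty_ge; exact: num_real. Qed.

Lemma cvg_pinfty_eq {T : topologicalType} (f g : R -> T) (l : T) :
  (forall t, 0 <= t -> f t = g t) -> f t @[t --> +oo] --> l -> g t @[t --> +oo] --> l.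
Proof.
move=> fg; apply: cvg_trans; apply: near_eq_cvg.
by apply: filterS near_pinfty_ge0 => t t0; rewrite fg.
Qed.

End restriction.

Theorem theorem12 (R : realType) (H : completeNormedModType R)
    (ip : {dot H for idfun}) (ip_norm : induces_norm ip)
    (A : H -> set H) (D B : H -> H) (L_D L_B : R)
    (A_max : maximally_monotone ip A)
    (L_D_gt0 : 0 < L_D) (L_B_gt0 : 0 < L_B)
    (D_coco : cocoercive ip L_D^-1 D) (B_coco : cocoercive ip L_B^-1 B)
    (C : set H) (C_def : C = zer (single B))
    (gamma lambda beta : R -> R)
    (gamma_pc : positive_continuous gamma)
    (lambda_pc : positive_continuous lambda)
    (beta_pc : positive_continuous beta)
    (u0 v0 : H) (x : R -> H)
    (x_sol : strong_global_solution A D B gamma lambda beta u0 v0 x)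
    (Z : set H)
    (Z_def : Z = zer (op_add (op_add A (single D)) (normal_cone ip C)))
    (ANC_max : maximally_monotone ip (op_add A (normal_cone ip C)))
    (Z_neq0 : Z !=set0)
    (lambda_L2 : square_integrable `[0, +oo[ (lambda : R -> R^o))
    (lambda_nL1 :
      ~ lebesgue_measure.-integrable `[0, +oo[ (EFin \o lambda))
    (lambda_cvg0 : lambda t @[t --> +oo] --> 0)
    (fitzpatrick_lty : forall p : H, ran (normal_cone ip C) p ->
      (\int[lebesgue_measure]_(t in `[0%R, +oo[)
         ((lambda t * beta t)%:E *
          (ereal_sup [set fitzpatrick ip B u ((beta t)^-1 *: p) | u in C] -
           support_fun ip C ((beta t)^-1 *: p))) < +oo)%E)
    (limsup_lt :
      (limf_esup (fun t => (lambda t * beta t)%:E) +oo%R < (L_B^-1)%:E)%E)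
    (gamma_lac : locally_abs_continuous (gamma : R -> R^o))
    (gamma_ae : {ae lebesgue_measure, forall t : R, 0 <= t ->
      [/\ Num.sqrt 2 <= gamma t, hderivable (gamma : R -> R^o) t
        & hderiv (gamma : R -> R^o) t <= 0]}) :
  [/\ [/\ forall xs, Z xs -> cvg (`|x t - xs| @[t --> +oo]),
          square_integrable `[0, +oo[ (hderiv x) /\
            square_integrable `[0, +oo[ (hderiv (hderiv x)),
          lebesgue_measure.-integrable `[0, +oo[
            (fun t => (lambda t * beta t * `|B (x t)| ^+ 2)%:E),
          forall xs, Z xs ->
            (\int[lebesgue_measure]_(t in `[0%R, +oo[)
               (lambda t * beta t * ip (B (x t)) (x t - xs))%:E < +oo)%E
        & hderiv x t @[t --> +oo] --> 0 /\
          forall xs, Z xs ->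
            hderiv (fun s => 2^-1 * `|x s - xs| ^+ 2 : R^o) t
              @[t --> +oo] --> 0],
      exists2 z, Z z & weakly_cvg_pinfty ip (weighted_average lambda x) z
    & strongly_monotone ip A ->
      exists z, Z = [set z] /\ x t @[t --> +oo] --> z].
Proof.
have [A_mon _] := A_max.
have [x_der x_lac v_lac x_ode _] := x_sol.
have [lam_gt0 _] := lambda_pc; have [bet_gt0 _] := beta_pc.
(* The clamped functions are continuous on the whole line and agree with the given ones on the
   half-line; only [a], known almost everywhere, is left as it is. *)
pose gc := (gamma \o clamp0) : R -> R.
pose lc := (lambda \o clamp0) : R -> R.
pose bc := (beta \o clamp0) : R -> R.
pose xc := x \o clamp0.
pose vc := hderiv x \o clamp0.
pose a := hderiv (hderiv x).
have cid T (f : R -> T) t : 0 <= t -> (f \o clamp0) t = f t.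
  by move=> t0; rewrite /= clamp0_id.
have cid' T (f : R -> T) t : 0 <= t -> f t = (f \o clamp0) t by move=> t0; rewrite cid.
have cl : continuous lc := positive_continuous_clamp0 lambda_pc.
have cb : continuous bc := positive_continuous_clamp0 beta_pc.
have cx : continuous xc := lac_continuous_clamp0 x_lac.
have cv : continuous vc := lac_continuous_clamp0 v_lac.
have lam0 t : 0 <= t -> 0 < lc t by move=> t0; rewrite /lc cid // lam_gt0.
have bet0 t : 0 <= t -> 0 < bc t by move=> t0; rewrite /bc cid // bet_gt0.
have lacx : locally_abs_continuous xc by apply: eq_locally_abs_continuous x_lac => t /cid'.
have lacv : locally_abs_continuous vc by apply: eq_locally_abs_continuous v_lac => t /cid'.
have lacg : locally_abs_continuous (gc : R -> R^o).
  by apply: eq_locally_abs_continuous gamma_lac => t /cid'.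
have xv t : 0 <= t -> hder xc t (vc t).
  move=> t0; rewrite /vc cid //; apply: (eq_hder t0 _ (x_der t t0)) => s; exact: cid'.
have a_der : {ae lebesgue_measure, forall t, 0 <= t -> hder vc t (a t)}.
  apply: ae_imply x_ode => t h t0; have [h1 _] := h t0.
  by apply: (eq_hder t0 _ h1) => s; exact: cid'.
have ode : {ae lebesgue_measure, forall t, 0 <= t -> hder vc t (a t) /\
    exists2 z, A (a t + gc t *: vc t + xc t) z &
      xc t - lc t *: D (xc t) - (lc t * bc t) *: B (xc t) =
      a t + gc t *: vc t + xc t + lc t *: z}.
  move: a_der x_ode; apply: ae_imply2 => t h1 h t0; split; first exact: h1.
  have [_ hr] := h t0; rewrite /gc /vc /xc /lc /bc !cid //.
  set w := _ + x t in hr *.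
  (* Reading the singleton equality as membership of [w] in the resolvent produces the element [z']
     of [A w]. *)
  have : [set w] w by [].
  rewrite -hr => -[y [z [<- [z' Az <-] ->]]].
  by exists z'.
have gam : {ae lebesgue_measure, forall t, 0 <= t -> Num.sqrt 2 <= gc t /\
    exists2 l : R^o, hder (gc : R -> R^o) t l & l <= 0}.
  apply: ae_imply gamma_ae => t h t0; have [h1 h2 h3] := h t0.
  rewrite /gc cid //; split => //; exists (hderiv (gamma : R -> R^o) t) => //.
  by apply: (eq_hder t0 _ h2) => s; exact: cid'.
have cl2 : continuous (fun t => lc t ^+ 2) by cts.
have lam_sqr : prim_bounded (fun t => lc t ^+ 2).
  apply: lty_prim_bounded => // [t _|]; first exact: sqr_ge0.
  have [_] := lambda_L2; apply: eq_half_line_lty => t t0.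
  by rewrite real_normK ?num_real // /lc cid.
have lam_inf M : exists2 t, 0 <= t & M < prim lc t.
  apply: contrapT => nM; apply: lambda_nL1.
  apply: (@integrable_half_line _ lc) => //.
  - by move=> t t0; exact/ltW/lam0.
  - by move=> t t0; rewrite /lc cid.
  - exists M => t t0; rewrite leNgt; apply/negP => h; apply: nM.
    by exists t.
have lam_cvg0 e : 0 < e -> exists T, forall t, T <= t -> lc t <= e.
  move=> e0; have /cvgrPdist_lt/(_ _ e0)[T [_ hT]] := lambda_cvg0.
  exists (Num.max 0 (T + 1)) => t; rewrite ge_max => /andP[t0 Tt].
  have Tt' : T < t by lra.
  by have := hT t Tt'; rewrite sub0r normrN /lc cid // => /(le_lt_trans (ler_norm _))/ltW.
have lam_bet : exists T, forall t, T <= t -> lc t * bc t <= L_B^-1.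
  (* The upper limit is an infimum of suprema over neighbourhoods of infinity, so one of these
     suprema is already below [L_B^-1]. *)
  have /ereal_inf_lt[_ [S [T [_ hT]] <-] hS] := limsup_lt.
  exists (Num.max 0 (T + 1)) => t; rewrite ge_max => /andP[t0 Tt].
  have Tt' : T < t by lra.
  rewrite /lc /bc !cid // -lee_fin; apply: (le_trans _ (ltW hS)).
  by apply: ereal_sup_ubound; exists t => //; exact: hT.
have cBx := cocoercive_continuous ip_norm L_B_gt0 B_coco cx.
subst C.
have fitz u p : normal_cone ip (zer (single B)) u p ->
    prim_bounded (fitz_gap ip B lc bc xc u p).
  move=> Nup; have [Cu Nu] := Nup.
  have cf : continuous (fitz_gap ip B lc bc xc u p) by rewrite /fitz_gap; cts.
  have cf4 : continuous (fun t => 4 * fitz_gap ip B lc bc xc u p t) by cts.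
  have f0 t : 0 <= fitz_gap ip B lc bc xc u p t by rewrite le_max lexx.
  suff h : prim_bounded (fun t => 4 * fitz_gap ip B lc bc xc u p t).
    apply: (prim_bounded_le cf cf4 _ h) => t t0.
    by have := f0 t; lra.
  apply: lty_prim_bounded => // [t t0|]; first by rewrite mulr_ge0.
  (* The factor 4 inverts the share 1/4 in [fitz_gap]; normal cones are stable under positive
     scaling. *)
  have ran4 : ran (normal_cone ip (zer (single B))) (4 *: p).
    exists u; split => // y Cy; rewrite ipZr; have := Nu y Cy; lra.
  apply: le_lt_trans (fitzpatrick_lty _ ran4).
  have key t : 0 <= t ->
    ((4 * fitz_gap ip B lc bc xc u p t)%:E <= (lambda t * beta t)%:E *
          (ereal_sup [set fitzpatrick ip B u0 ((beta t)^-1 *: (4 *: p)) | u0 in zer (single B)] -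
           support_fun ip (zer (single B)) ((beta t)^-1 *: (4 *: p))))%E.
    move=> t0; have b0 := bet_gt0 t t0; have l0 := lam_gt0 t t0.
    set p' := (beta t)^-1 *: (4 *: p).
    have bi0 : 0 < (beta t)^-1 by rewrite invr_gt0.
    (* As [p] is normal to the zero set at [u], the supremum is attained at [u], which makes the gap
       a difference with a real number. *)
    have -> : support_fun ip (zer (single B)) p' = (ip u p')%:E.
      apply/eqP; rewrite eq_le; apply/andP; split; last first.
        by apply: ereal_sup_ubound; exists u.
      apply: ge_ereal_sup => _ [y Cy <-]; rewrite lee_fin -subr_ge0 -ipBl.
      rewrite !ipZr !mulr_ge0 ?(ltW bi0) // -opprB ipNl oppr_ge0; exact: Nu.
    have Bu : B u = 0 by [].
    have sup_ge y : ((ip u (B y) + ip y p' - ip y (B y))%:E <=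
        ereal_sup [set fitzpatrick ip B u0 p' | u0 in zer (single B)])%E.
      apply: (@le_trans _ _ (fitzpatrick ip B u p')).
        by apply: ereal_sup_ubound; exists y.
      by apply: ereal_sup_ubound; exists u.
    set S := ereal_sup _ in sup_ge *.
    have bound y : (((lambda t * beta t) * (ip u (B y) + ip y p' - ip y (B y) - ip u p'))%:E <=
        (lambda t * beta t)%:E * (S - (ip u p')%:E))%E.
      rewrite EFinM EFinB lee_pmul2l ?lte_fin ?mulr_gt0 //.
      by rewrite leeB.
    (* The value 0 of the maximum is covered by the test point [u], where [B u = 0]; the other value
       is the one at the test point [x t]. *)
    rewrite /fitz_gap /Num.max; case: ifP => _; last first.
      by apply: le_trans (bound u); rewrite lee_fin Bu !linear0r; lra.
    apply: le_trans (bound (x t)); rewrite lee_fin /lc /bc /xc !cid // /p' !ipZr !ipBl.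
    by rewrite le_eqVlt; apply/orP; left; apply/eqP; field; rewrite gt_eqF.
  apply: ae_ge0_le_integral_nonmeasurable => [t|t|].
  - by rewrite /= in_itv /= andbT lee_fin => t0; rewrite mulr_ge0.
  - rewrite /= in_itv /= andbT => /key; apply: le_trans.
    by rewrite lee_fin mulr_ge0.
  - by apply: ae_of_all => t; rewrite /= in_itv /= andbT => /key.
have [xs0 Z0] := Z_neq0.
rewrite Z_def in Z0.
have [dist_cvg [v_sq a_sq] [B_sq B_ip] [v_cvg0 ip_cvg0] [weak strong]] :=
  trajectory_convergence ip_norm L_D_gt0 L_B_gt0 D_coco B_coco cl cb cx cv lam0 bet0
    lacx lacv lacg xv ode gam lam_sqr lam_inf lam_cvg0 lam_bet fitz A_mon ANC_max Z0.
have lb0 t : 0 <= t -> 0 <= lc t * bc t.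
  by move=> t0; rewrite mulr_ge0 // ltW ?lam0 ?bet0.
rewrite -Z_def in dist_cvg B_ip ip_cvg0 weak strong.
split.
- split.
  + move=> xs /dist_cvg/cvg_ex[l hl]; apply/cvg_ex; exists l.
    by apply: cvg_pinfty_eq hl => t t0; rewrite /xc cid.
  + split; split.
    * apply: (strongly_measurable_lim (fun=> cv)) => //.
      by apply: ae_of_all => t t0; rewrite [in X in _ --> X]cid' //; exact: cvg_cst.
    * apply: eq_half_line_lty v_sq => t t0.
      by rewrite /vc cid.
    * apply: (@strongly_measurable_lim _ _ _ _
        (fun n t => (n.+1%:R^-1)^-1 *: (vc (t + n.+1%:R^-1) - vc t))) => //.
        move=> n; apply: ctsZ; first exact: ctsC.
        by apply: ctsB => //; exact: continuous_shift.
      by apply: ae_imply a_der => t h t0; apply: hder_harmonic => //; exact: h.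
    * exact: a_sq.
  + apply: (integrable_half_line _ _ _ B_sq).
    * by cts.
    * by move=> t t0; rewrite mulr_ge0 ?lb0 ?sqr_ge0.
    * by move=> t t0; rewrite /lc /bc /xc !cid.
  + move=> xs Zxs.
    have cI : continuous (fun t => lc t * bc t * ip (xc t - xs) (B (xc t))) by cts.
    have I0 t : 0 <= t -> 0 <= lc t * bc t * ip (xc t - xs) (B (xc t)).
      move=> t0; rewrite mulr_ge0 ?lb0 //.
      have Bxs : B xs = 0 by move: Zxs; rewrite Z_def => /zerP[].
      exact: (@ip_B_ge0 _ _ _ B L_B xc L_B_gt0 B_coco xs t Bxs).
    apply: eq_half_line_lty (prim_bounded_lty cI I0 (B_ip xs Zxs)) => t t0.
    by rewrite ipC /lc /bc /xc !cid.
  + split.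
      by apply: cvg_pinfty_eq v_cvg0 => t t0; rewrite /vc cid.
    (* The derivative of half the squared distance is [ip (x t - xs) (hderiv x t)], already known to
       vanish at infinity. *)
    move=> xs /ip_cvg0; apply: cvg_pinfty_eq => t t0.
    rewrite /xc /vc !cid //; apply/esym/hder_lim => //.
    have hxu : hder (fun s => x s - xs) t (hderiv x t).
      by have := hderB (hderP t0 (x_der t t0)) (hder_cst xs t); rewrite subr0.
    have := hderM (hder_cst (2^-1 : R^o) t) (hder_ip ip_norm hxu hxu).
    congr (hder _ _ _).
      by apply/funext => s; rewrite ip_norm.
    by rewrite mul0r add0r [ip (hderiv x t) _]ipC; field.
- have [z Zz zlim] := weak; exists z; first exact: Zz.
  move=> y.
  apply: cvg_pinfty_eq (zlim y) => t t0.
  have E1 : prim lc t = \int[lebesgue_measure]_(s in `[0, t]) lambda s.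
    by apply: eq_Rintegral => s; rewrite inE /= in_itv /= => /andP[s0 _]; rewrite /lc cid.
  have E2 : bochner_integral `[0, t] (fun s => lc s *: xc s) =
      bochner_integral `[0, t] (fun s => lambda s *: x s).
    apply: eq_bochner_integral => s; rewrite /= in_itv /= => /andP[s0 _].
    by rewrite /lc /xc !cid.
  by rewrite /average /weighted_average E1 E2.
- move=> [eta eta0 mono].
  have mono' y w y' w' : A y w -> A y' w' -> eta * `|y - y'| ^+ 2 <= ip (w - w') (y - y').
    by move=> h1 h2; exact: mono.
  have xlim z : Z z -> x t @[t --> +oo] --> z.
    move=> Zz; apply: cvg_pinfty_eq (strong eta z eta0 mono' Zz) => t t0.
    by rewrite /xc cid.
  have [z Zz] := Z_neq0; exists z; split; last exact: xlim.
  apply/seteqP; split=> [y Zy|y ->] //=.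
  exact: (cvg_unique (@norm_hausdorff _ H) (xlim y Zy) (xlim z Zz)).
Qed.
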